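(* Let $(x_n)_{n\ge0}$ be a time-homogeneous Markov chain on $S=\{1,\dots,d\}$ with arbitrary initial distribution, whose transition matrix $P=(p_{jk})$ has all entries positive. Let $\mathbf h=(h_{jk})\in M(d,\mathbb R)$ be such that there are no constants $c\in\mathbb R$, $r\ne0$ and vector $H\in\mathbb R^d$ with $rh_{jk}=c+H(k)-H(j)\bmod2\pi$ for all $j,k$. Let $X_n=h_{x_nx_{n+1}}$, $S_N=X_1+\dots+X_N$, assume $\lim_N\mathbb E(S_N)/N=0$, and let $B=\lim_{n\to\infty}B_n/n$ with $B_n=\sup\{\sum_{j=1}^nh_{x_{j-1}x_j}:x_0,\dots,x_n\in S\}$. Then $S_N$ admits the strong asymptotic expansion of order $0$ for large deviations in the range $(0,B)$: for each $a\in(0,B)$ there is $D_0(a)$ with $\mathbb P(S_N\ge aN)e^{I(a)N}=D_0(a)N^{-1/2}+o(N^{-1/2})$.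
   Context: Rate function: $I(a)=\sup_{\theta>0}[a\theta-\Lambda(\theta)]$ with $\Lambda(\theta)=\lim_N\frac1N\log\mathbb E(e^{\theta S_N})$. *)

(* Defs.v *)
From mathcomp Require Import all_boot all_order all_algebra.
From mathcomp Require Import all_classical all_reals all_analysis.
Set Implicit Arguments. Unset Strict Implicit. Unset Printing Implicit Defensive.
Import Order.TTheory GRing.Theory Num.Theory numFieldNormedType.Exports.
Local Open Scope ring_scope.
Local Open Scope classical_set_scope.

Section MarkovDefs.
Variables (R : realType) (d : nat).

Definition path_prob (mu : 'I_d -> R) (P : 'M[R]_d) (n : nat)
    (x : {ffun 'I_n.+1 -> 'I_d}) : R :=
  mu (x ord0) * \prod_(i < n) P (x (inord i)) (x (inord i.+1)).

Definition SN (h : 'M[R]_d) (N : nat) (x : {ffun 'I_N.+2 -> 'I_d}) : R :=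
  \sum_(1 <= i < N.+1) h (x (inord i)) (x (inord i.+1)).

Definition expect (mu : 'I_d -> R) (P : 'M[R]_d) (N : nat)
    (f : {ffun 'I_N.+2 -> 'I_d} -> R) : R :=
  \sum_(x : {ffun 'I_N.+2 -> 'I_d}) path_prob mu P x * f x.

Definition prob_ge (mu : 'I_d -> R) (P h : 'M[R]_d) (a : R) (N : nat) : R :=
  @expect mu P N (fun x => if a * N%:R <= @SN h N x then 1 else 0).

Definition Lambda (mu : 'I_d -> R) (P h : 'M[R]_d) (t : R) : R :=
  limn (fun N : nat => ln (@expect mu P N (fun x => expR (t * @SN h N x))) / N%:R).

Definition rate (mu : 'I_d -> R) (P h : 'M[R]_d) (a : R) : R :=
  sup [set y | exists2 t : R, 0 < t & y = a * t - Lambda mu P h t].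

Definition Bn (h : 'M[R]_d) (n : nat) : R :=
  sup [set y | exists x : {ffun 'I_n.+1 -> 'I_d},
        y = \sum_(1 <= j < n.+1) h (x (inord j.-1)) (x (inord j))].

Definition Bconst (h : 'M[R]_d) : R := limn (fun n : nat => Bn h n / n%:R).

Definition nonlattice (h : 'M[R]_d) : Prop :=
  ~ exists (c r : R) (H : 'I_d -> R), r != 0 /\
      forall j k : 'I_d, exists m : int,
        r * h j k = c + H k - H j + m%:~R * (2 * pi).

End MarkovDefs.

(* Main.v *)
Require Import Defs.
From mathcomp Require Import all_boot all_order all_algebra.
From mathcomp Require Import all_classical all_reals all_analysis.
From mathcomp Require Import measurable_realfun.
From mathcomp Require Import complex.
From mathcomp Require Import ring lra.
Set Implicit Arguments. Unset Strict Implicit. Unset Printing Implicit Defensive.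
Import Order.TTheory GRing.Theory Num.Theory numFieldNormedType.Exports.
Local Open Scope ring_scope.
Local Open Scope classical_set_scope.

(** The function
[a t - Lambda t] attains its supremum over [t >= 0] at some [t > 0], since
[Lambda] has drift [0] at [0] and slope at least [b > a] at infinity.
Tilting the transition matrix by [expR (t * h)] and its Perron eigenvector
gives a chain whose stationary drift is exactly [a], and
[P(S_N >= a N) expR (I(a) N)] becomes the sum of the weights
[expR (- t T) 1_{T >= 0}] with [T = S_N - a N] under the tilted chain.

The latter sum, times [sqrt N], converges by Fourier analysis.  For the twisted
matrix [M_s(j,k) = Q(j,k) expR (i s (h(j,k) - a))]:
- the non-lattice condition makes two steps of [M_s] contract the sup norm by
  [1 - c s^2], uniformly on each interval [0 <= s <= A];
- [M_{u / sqrt N}^N g] tends to a multiple of [expR (- sigma u^2 / 2)].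
By dominated convergence the weighted sums of Fejer kernels [K_A(T - b)] times
[sqrt N] converge to a limit independent of [A] and [b].  Convolving [K_A] with
the exponential tail, shifted by [+- e], sandwiches [expR (- t T) 1_{T >= 0}]
between two test functions whose limits have ratio tending to [1] as [e -> 0],
[A e^2 -> oo]; both bounds carry the same factor [int_{-e}^{e} K_A], so the total
mass of the kernel is never computed. *)

(** * Elementary inequalities *)

Section Elementary.
Context {R : realType}.
Implicit Types x y : R.

(** For fixed [N], [S_N] takes finitely many values, so its characteristic function does not tend to
    zero at high frequency; the non-lattice condition controls it only on bounded frequency
    intervals, with constants depending on the interval.

    [Lambda] is never differentiated. Any positive vector [v] with [M v <= rho v] bounds the Perron
    eigenvalue from above by [rho], which gives a one-sided quadratic bound for [Lambda] at every
    point; at an extremum a one-sided bound already forces the slope.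

    The stationary law is never constructed: its averages appear as the constants [m] in the Poisson
    equation [f = m + x - Q x]. Correctors obtained from this equation also centre the increments by
    a coboundary and correct the approximate eigenvector. *)

Lemma ge0_of_derive_ge0 (f f' : R -> R) : (forall x, is_derive x 1 f (f' x)) ->
  (forall x, 0 <= x -> 0 <= f' x) -> f 0 = 0 -> forall x, 0 <= x -> 0 <= f x.
Proof.
move=> df f'0 f0 x; rewrite le_eqVlt => /predU1P[<-|x0]; first by rewrite f0.
have [|c cx] := @MVT R f f' 0 x x0 (fun z _ => df z).
  by apply: derivable_within_continuous => z _; apply: ex_derive.
rewrite f0 !subr0 => ->; apply: mulr_ge0; last exact: ltW.
by apply: f'0; move: cx; rewrite in_itv/= => /andP[/ltW].
Qed.

(** Integration of [1 - cos >= 0]. The next three bounds continue the chain: the derivative of each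
    defect is the defect of the preceding bound. *)
Lemma sin_le_id x : 0 <= x -> sin x <= x.
Proof.
move=> x0; rewrite -subr_ge0.
apply: (@ge0_of_derive_ge0 (fun x => x - sin x) (fun x => 1 - cos x)).
- by move=> y _; rewrite subr_ge0 cos_le1.
- by rewrite sin0 subr0.
- exact: x0.
Qed.

Lemma cos_ge_quad x : 1 - x ^+ 2 / 2 <= cos x.
Proof.
wlog x0 : x / 0 <= x.
  have [x0|/ltW x0] := leP 0 x; first exact.
  by rewrite -cosN -sqrrN; apply; rewrite oppr_ge0.
rewrite -subr_ge0.
have df y : is_derive y 1 (fun x => cos x - (1 - x ^+ 2 / 2)) ((fun x => x - sin x) y).
  apply: is_derive_eq; rewrite -?[_ *: _]/(_ * _) /=; by field.
apply: (ge0_of_derive_ge0 df _ _ x0).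
- by move=> y y0; rewrite subr_ge0 sin_le_id.
- rewrite cos0; ring.
Qed.

Lemma sin_ge_cubic x : 0 <= x -> x - x ^+ 3 / 6 <= sin x.
Proof.
move=> x0; rewrite -subr_ge0.
have df y : is_derive y 1 (fun x => sin x - (x - x ^+ 3 / 6)) ((fun x => cos x - (1 - x ^+ 2 / 2)) y).
  apply: is_derive_eq; rewrite -?[_ *: _]/(_ * _) /=; by field.
apply: (ge0_of_derive_ge0 df _ _ x0).
- by move=> y y0; rewrite subr_ge0 cos_ge_quad.
- rewrite sin0; ring.
Qed.

Lemma cos_le_quartic x : cos x <= 1 - x ^+ 2 / 2 + x ^+ 4 / 24.
Proof.
wlog x0 : x / 0 <= x.
  have [x0|/ltW x0] := leP 0 x; first exact.
  rewrite -cosN -sqrrN.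
  have -> : x ^+ 4 = (- x) ^+ 4 by ring.
  by apply; rewrite oppr_ge0.
rewrite -subr_ge0.
have df y : is_derive y 1 (fun x => (1 - x ^+ 2 / 2 + x ^+ 4 / 24) - cos x) ((fun x => sin x - (x - x ^+ 3 / 6)) y).
  apply: is_derive_eq; rewrite -?[_ *: _]/(_ * _) /=; by field.
apply: (ge0_of_derive_ge0 df _ _ x0).
- by move=> y y0; rewrite subr_ge0 sin_ge_cubic.
- rewrite cos0; ring.
Qed.

Lemma sin_taylor x : `|sin x - x| <= `|x| ^+ 3.
Proof.
wlog x0 : x / 0 <= x.
  have [x0|/ltW x0] := leP 0 x; first exact.
  have -> : sin x - x = - (sin (- x) - (- x)) by rewrite sinN; ring.
  by rewrite normrN -(normrN x); apply; rewrite oppr_ge0.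
rewrite (ger0_norm x0) ler_norml.
have := sin_le_id x0; have := sin_ge_cubic x0; have := exprn_ge0 3 x0; lra.
Qed.

Lemma cos_taylor x : `|cos x - (1 - x ^+ 2 / 2)| <= `|x| ^+ 3.
Proof.
rewrite ger0_norm ?subr_ge0 ?cos_ge_quad//.
have [x1|x1] := leP `|x| 1.
  have h1 := cos_le_quartic x.
  have h2 : x ^+ 4 = `|x| ^+ 3 * `|x|.
    by rewrite -exprSr (@exprM _ _ 2 2) [RHS](@exprM _ _ 2 2) real_normK ?num_real.
  have h3 : `|x| ^+ 3 * `|x| <= `|x| ^+ 3 by rewrite ler_piMr// exprn_ge0.
  have h4 : 0 <= `|x| ^+ 3 by rewrite exprn_ge0.
  lra.
have h1 := cos_le1 x.
have h2 : x ^+ 2 = `|x| ^+ 2 by rewrite real_normK ?num_real.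
have h3 : `|x| ^+ 2 <= `|x| ^+ 3 by rewrite ler_weXn2l// ltW.
have h4 : 0 <= `|x| ^+ 2 by rewrite exprn_ge0.
lra.
Qed.

Lemma one_sub_cos_ge x : `|x| <= 1 -> x ^+ 2 / 4 <= 1 - cos x.
Proof.
move=> x1; have := cos_le_quartic x.
have -> : x ^+ 4 = x ^+ 2 * x ^+ 2 by ring.
have : x ^+ 2 <= 1 by rewrite -real_normK ?num_real// exprn_ile1.
have := sqr_ge0 x; move: (x ^+ 2) => q q0 q1 qc.
have : q * q <= q by rewrite ler_piMr.
lra.
Qed.

(** Multiplying by [1 - x > 0] reduces it to [expR x * (1 - x) <= expR x * expR (- x) = 1] and [(1 +
    x + 2 x^2)(1 - x) = 1 + x^2 (1 - 2 x) >= 1]. *)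
Lemma expR_le_quad x : `|x| <= 1 / 2 -> expR x <= 1 + x + 2 * x ^+ 2.
Proof.
rewrite ler_norml => /andP[x1 x2].
have h := expR_ge1Dx (- x).
have h0 := expR_gt0 x.
have h1 : expR x * expR (- x) = 1 by rewrite -expRD subrr expR0.
have h2 : expR x * (1 - x) <= 1 by rewrite -[leRHS]h1 ler_pM2l.
have h3 : 1 <= (1 + x + 2 * x ^+ 2) * (1 - x).
  have -> : (1 + x + 2 * x ^+ 2) * (1 - x) = 1 + x ^+ 2 * (1 - 2 * x) by ring.
  by rewrite lerDl mulr_ge0 ?sqr_ge0//; lra.
have x3 : 0 < 1 - x by lra.
by rewrite -(ler_pM2r x3) (le_trans h2).
Qed.

End Elementary.

(** * Integrals over the half-line *)

Section HalfLine.
Context {R : realType}.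
Implicit Types (f : R -> R) (x c C : R).
Local Notation mu := (@lebesgue_measure R).
Local Notation hl := (`[0, +oo[%classic : set R).
Local Notation hintegrable f := (mu.-integrable hl (EFin \o f)).
Local Notation hint f := (Rintegral mu hl f).

Lemma integrable_expR_tail C c : 0 < c -> hintegrable (fun x => C * expR (- c * x)).
Proof.
move=> c0.
have := @integrable_exponential_pdf R c c0 => /(integrableS measurableT) h.
have {h} := h hl _ (@subsetT _ _) => h.
have {}h : hintegrable (exponential_pdf c) by apply: h.
have : mu.-integrable hl (fun x => ((C / c)%:E * (EFin \o exponential_pdf c) x)%E).
  exact: integrableZl.
apply: eq_integrable => // x; rewrite inE/= in_itv/= andbT => x0.
rewrite /= exponential_pdfE//; congr EFin.
by field; rewrite gt_eqF.
Qed.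

Lemma integrable_exp_bound f C c : 0 < c -> measurable_fun hl f ->
  (forall x, 0 <= x -> `|f x| <= C * expR (- c * x)) -> hintegrable f.
Proof.
move=> c0 mf fC.
apply: (le_integrable _ _ _ (integrable_expR_tail C c0)) => //.
- exact/measurable_EFinP.
- move=> x /=; rewrite in_itv/= andbT => x0; rewrite lee_fin.
  by rewrite (le_trans (fC _ x0))// ler_norm.
Qed.

(** Dominated convergence with an exponential majorant, applied once in the frequency and once in
    the shift of the kernel. *)
Lemma hint_cvg (f_ : nat -> R -> R) f C c : 0 < c ->
  (forall n, measurable_fun hl (f_ n)) ->
  (forall n x, 0 <= x -> `|f_ n x| <= C * expR (- c * x)) ->
  (forall x, 0 <= x -> f_ n x @[n --> \oo] --> f x) ->
  hint (f_ n) @[n --> \oo] --> hint f.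
Proof.
move=> c0 mf fC ff.
have mf' : measurable_fun hl f.
  apply: (measurable_fun_cvg mf) => x /=; rewrite in_itv/= andbT; exact: ff.
have mE n : measurable_fun hl (EFin \o f_ n) by exact/measurable_EFinP.
have mE' : measurable_fun hl (EFin \o f) by exact/measurable_EFinP.
have [||h1 _ h2] := @dominated_convergence _ _ R mu hl (measurable_itv _) _ _ _ mE mE' _
  (integrable_expR_tail C c0).
- apply/aeW => x; rewrite /= in_itv/= andbT => x0.
  by apply: cvg_EFin; [exact: nearW|apply: ff].
- apply/aeW => x n; rewrite /= in_itv/= andbT => x0.
  by rewrite lee_fin fC.
apply: fine_cvg.
by rewrite fineK//; exact: (integrable_fin_num _ h1).
Qed.

Lemma hint_sum (I : finType) (w : I -> R) (F : I -> R -> R) :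
  (forall i, hintegrable (F i)) ->
  hintegrable (fun x => \sum_i w i * F i x) /\
  hint (fun x => \sum_i w i * F i x) = \sum_i w i * hint (F i).
Proof.
move=> iF.
elim: (index_enum I) => [|i s [ih1 ih2]].
  have -> : (fun x => \sum_(i <- [::]) w i * F i x) = (fun=> 0).
    by apply/funext => x; rewrite big_nil.
  split; first exact: (@integrable0 _ _ R mu hl).
  by rewrite Rintegral_cst// mul0r big_nil.
have iFi : hintegrable (fun x => w i * F i x).
  exact: (@integrableZl _ _ R mu hl (measurable_itv _) (w i) _ (iF i)).
have -> : (fun x => \sum_(j <- i :: s) w j * F j x) =
          (fun x => w i * F i x + \sum_(j <- s) w j * F j x).
  by apply/funext => x; rewrite big_cons.
split.
  exact: (@integrableD _ _ R mu hl (measurable_itv _) _ _ iFi ih1).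
by rewrite RintegralD// big_cons ih2 RintegralZl.
Qed.

End HalfLine.

(** * Fejer kernels *)

Section Fejer.
Context {R : realType}.
Implicit Types (f F : R -> R) (x y z a b c A C : R).
Local Notation mu := (@lebesgue_measure R).
Local Notation hl := (`[0, +oo[%classic : set R).
Local Notation hintegrable f := (mu.-integrable hl (EFin \o f)).
Local Notation hint f := (Rintegral mu hl f).

Lemma Rintegral_FTC f F a b : a < b -> continuous f ->
  (forall x, is_derive x 1 F (f x)) ->
  Rintegral mu `[a, b] f = F b - F a.
Proof.
move=> ab cf dF; rewrite /Rintegral (@continuous_FTC2 _ f F)//.
- exact: continuous_subspaceT.
- have cF : continuous F by move=> x; apply: differentiable_continuous;
    apply/derivable1_diffP.
  split.
  + by move=> x _; apply: ex_derive.
  + by apply: cvg_at_right_filter; exact: cF.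
  + by apply: cvg_at_left_filter; exact: cF.
- by move=> x _; rewrite derive1E; apply: derive_val.
Qed.

Lemma Rintegral_shift f a b z : a <= b -> continuous f ->
  Rintegral mu `[a + z, b + z] (fun x => f (x - z)) = Rintegral mu `[a, b] f.
Proof.
move=> ab cf; rewrite /Rintegral.
have dF x : is_derive x 1 (fun x => x + z) 1.
  by apply: is_derive_eq; rewrite addr0.
have F'E : (fun x => x + z)^`()%classic = cst 1.
  by apply/funext => x; rewrite derive1E derive_val.
have cg : continuous (fun x => f (x - z)).
  move=> x; apply: (@continuous_comp _ _ _ (fun x => x - z) f); last exact: cf.
  by apply: continuousB => //; exact: cst_continuous.
have cF : continuous (fun x : R => x + z).
  by move=> x; apply: continuousD => //; exact: cst_continuous.
rewrite (@integration_by_substitution_increasing _ (fun x => x + z) (fun x => f (x - z)))//.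
- by congr fine; apply: eq_integral => x _; rewrite F'E !fctE/= addrK mulr1.
- by move=> x y _ _; rewrite ltrD2r.
- by rewrite F'E => ? _; exact: cst_continuous.
- by rewrite F'E; exact: is_cvg_cst.
- by rewrite F'E; exact: is_cvg_cst.
- split.
  + by move=> x _; apply: ex_derive.
  + by apply: cvg_at_right_filter; exact: cF.
  + by apply: cvg_at_left_filter; exact: cF.
- exact: continuous_subspaceT.
Qed.

(** The cosine transform of [hat A] over the half-line, not normalised to total mass one. The value
    at [0] is the limit, which the quotient would miss because division by zero yields [0]. *)
Definition fejer A y : R := if y == 0 then A / 2 else (1 - cos (A * y)) / (A * y ^+ 2).

Arguments fejer : simpl never.

Definition hat A x : R := Num.max 0 (1 - x / A).

Lemma hat_ge0 A x : 0 <= hat A x. Proof. by rewrite /hat le_max lexx. Qed.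

Lemma hat_le1 A x : 0 < A -> 0 <= x -> hat A x <= 1.
Proof. by move=> A0 x0; rewrite /hat ge_max ler01 gerBl divr_ge0// ltW. Qed.

(** An exponential majorant for a compactly supported function lets every integral run over the same
    half-line. *)
Lemma hat_le_expR A x : 0 < A -> 0 <= x -> hat A x <= expR A * expR (- x).
Proof.
move=> A0 x0; rewrite -expRD.
have [xA|xA] := leP x A.
  by rewrite (le_trans (hat_le1 A0 x0))// -expR0 ler_expR subr_ge0.
rewrite /hat max_l ?expR_ge0// subr_le0 ler_pdivlMr// mul1r ltW//.
Qed.

Lemma continuous_hat A : continuous (hat A).
Proof.
move=> x; apply: (@continuous_max _ _ (fun=> 0) (fun x => 1 - x / A)).
  exact: cst_continuous.
apply: continuousB; first exact: cst_continuous.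
by apply: continuousM => //; exact: cst_continuous.
Qed.

Lemma continuous_cosM y : continuous (fun x => cos (x * y)).
Proof.
move=> x; apply: (@continuous_comp _ _ _ (fun x => x * y) cos); last exact: continuous_cos.
by apply: continuousM => //; exact: cst_continuous.
Qed.

Lemma continuous_hat_cos A y : continuous (fun x => hat A x * cos (x * y)).
Proof.
move=> x; apply: (@continuousM _ _ (hat A) (fun x => cos (x * y))).
  exact: continuous_hat.
exact: continuous_cosM.
Qed.

Lemma integrable_hat_cos A y : 0 < A -> hintegrable (fun x => hat A x * cos (x * y)).
Proof.
move=> A0; apply: (@integrable_exp_bound _ _ (expR A) 1) => //.
  apply: measurable_funTS; apply: continuous_measurable_fun; exact: continuous_hat_cos.
move=> x x0; rewrite mulN1r normrM (ger0_norm (hat_ge0 _ _)).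
by rewrite (le_trans _ (hat_le_expR A0 x0))// ler_piMr ?hat_ge0// cos_max.
Qed.

Lemma hint_hat_cos A y : 0 < A -> hint (fun x => hat A x * cos (x * y)) = fejer A y.
Proof.
move=> A0.
pose g x := (1 - x / A) * cos (x * y).
have -> : hint (fun x => hat A x * cos (x * y)) = Rintegral mu `[0, A] g.
  rewrite (_ : `[0, A]%classic = hl `&` `[0, A]); last first.
    by rewrite setIidr//; exact: subset_itvl.
  rewrite Rintegral_mkcondr; apply: eq_Rintegral => x; rewrite inE/= in_itv/= andbT => x0.
  rewrite patchE /hat; case: ifPn; rewrite ?notin_setE ?inE/= in_itv/= x0/=.
    by move=> xA; rewrite max_r// subr_ge0 ler_pdivrMr// mul1r.
  move/negP; rewrite -ltNge => xA; rewrite max_l ?mul0r// subr_le0 ler_pdivlMr// mul1r ltW//.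
have cg : continuous g.
  move=> x; apply: (@continuousM _ _ (fun x => 1 - x / A) (fun x => cos (x * y))); last exact: continuous_cosM.
  apply: continuousB; first exact: cst_continuous.
  by apply: continuousM => //; exact: cst_continuous.
have A1 : A != 0 by rewrite gt_eqF.
rewrite /fejer; case: eqP => [y0|/eqP y0].
  have dF x : is_derive x 1 (fun x => x - x ^+ 2 / (2 * A)) (g x).
    by apply: is_derive_eq; rewrite /g y0 mulr0 cos0 -?[_ *: _]/(_ * _) /=; field.
  by rewrite (Rintegral_FTC A0 cg dF); field.
have dF x : is_derive x 1
    (fun x => (1 - x / A) * (sin (x * y) / y) - cos (x * y) / (A * y ^+ 2)) (g x).
  apply: is_derive_eq; rewrite /g -?[_ *: _]/(_ * _) /=; field.
  by rewrite y0 A1.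
rewrite (Rintegral_FTC A0 cg dF) !mul0r sin0 cos0 mul0r mulr0 divff// subrr mul0r; field.
by rewrite y0 A1.
Qed.

Lemma fejerE A y : 0 < A -> A * y ^+ 2 * fejer A y = 1 - cos (A * y).
Proof.
move=> A0; rewrite /fejer; case: eqP => [->|/eqP y0].
  by rewrite mulr0 cos0; ring.
by field; rewrite y0 gt_eqF.
Qed.

Lemma fejer_ge0 A y : 0 < A -> 0 <= fejer A y.
Proof.
move=> A0; rewrite /fejer; case: ifP => _; first by rewrite divr_ge0// ltW.
by rewrite divr_ge0 ?subr_ge0 ?cos_le1// mulr_ge0 ?sqr_ge0// ltW.
Qed.

(** With [r = sqrt n] this turns the factor [sqrt n] of the local limit into a rescaling of the
    frequency. *)
Lemma fejer_scale A r y : 0 < r -> 0 < A -> fejer (A * r) (y / r) = r * fejer A y.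
Proof.
move=> r0 A0; have [rn An] : r != 0 /\ A != 0 by rewrite !gt_eqF.
rewrite /fejer mulf_eq0 invr_eq0 (negbTE rn) orbF; case: eqP => [_|/eqP y0]; first by field.
have -> : A * r * (y / r) = A * y by field.
by field; rewrite y0 rn An.
Qed.

Lemma fejer_near0 A y : 0 < A -> `|y| <= A^-1 -> A / 4 <= fejer A y.
Proof.
move=> A0 yA; rewrite /fejer; case: eqP => [_|/eqP y0]; first by lra.
have h : (A * y) ^+ 2 / 4 <= 1 - cos (A * y).
  by apply: one_sub_cos_ge; rewrite normrM gtr0_norm// -ler_pdivlMl// mulr1.
rewrite ler_pdivlMr; last by rewrite mulr_gt0// exprn_even_gt0.
by rewrite (le_trans _ h)// le_eqVlt; apply/orP; left; apply/eqP; field.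
Qed.

Lemma cos_lipschitz x y : `|cos x - cos y| <= `|x - y|.
Proof.
wlog xy : x y / y <= x.
  by move=> h; have [/h//|/ltW/h] := leP y x; rewrite distrC (distrC y).
have [h0 ->] : 0 <= x - y /\ x = y + (x - y) by split; [rewrite subr_ge0|ring].
move: (x - y) h0 => h h0; rewrite addrAC subrr add0r (ger0_norm h0) ler_norml.
have df1 (t : R) : is_derive t 1 (fun t => t - (cos (y + t) - cos y)) (1 + sin (y + t)).
  by apply: is_derive_eq; rewrite -?[_ *: _]/(_ * _) /=; ring.
have df2 (t : R) : is_derive t 1 (fun t => t + (cos (y + t) - cos y)) (1 - sin (y + t)).
  by apply: is_derive_eq; rewrite -?[_ *: _]/(_ * _) /=; ring.
have h1 : 0 <= h - (cos (y + h) - cos y).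
  apply: (ge0_of_derive_ge0 df1 _ _ h0) => [t _|]; last by rewrite addr0; ring.
  by have := sin_geN1 (y + t); lra.
have h2 : 0 <= h + (cos (y + h) - cos y).
  apply: (ge0_of_derive_ge0 df2 _ _ h0) => [t _|]; last by rewrite addr0; ring.
  by have := sin_le1 (y + t); lra.
by lra.
Qed.

(** In the integral representation the point [y = 0] is not exceptional: [cos] is 1-Lipschitz and
    [x * hat A x <= A * expR (A - x)], whose integral is the constant. *)
Lemma fejer_lipschitz A : 0 < A -> exists C, forall y z, `|fejer A y - fejer A z| <= C * `|y - z|.
Proof.
move=> A0; pose E x := A * (expR A * expR (- 1 * x)).
have iE : hintegrable E.
  have := integrable_expR_tail (A * expR A) (@ltr01 R).
  by apply: eq_integrable => // x _; rewrite /E/= mulrA.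
exists (hint E) => y z.
rewrite -!hint_hat_cos// -RintegralB//; try exact: integrable_hat_cos.
have iB : hintegrable (fun x => hat A x * cos (x * y) - hat A x * cos (x * z)).
  exact: (@integrableB _ _ R mu hl (measurable_itv _) _ _
    (integrable_hat_cos y A0) (integrable_hat_cos z A0)).
apply: (le_trans (@le_normr_Rintegral _ _ R mu hl _ (measurable_itv _) iB)).
rewrite -RintegralZr//; apply: le_Rintegral => //.
- by have := @integrable_norm _ _ R mu hl _ iB; apply: eq_integrable.
- by have := @integrableZr _ _ R mu hl (measurable_itv _) `|y - z| _ iE; apply: eq_integrable.
move=> x; rewrite /= in_itv/= andbT => x0.
rewrite -mulrBr normrM (ger0_norm (hat_ge0 _ _)) /E mulN1r.
have h1 : `|cos (x * y) - cos (x * z)| <= x * `|y - z|.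
  by rewrite (le_trans (cos_lipschitz _ _))// -mulrBr normrM (ger0_norm x0).
apply: le_trans (ler_wpM2l (hat_ge0 _ _) h1) _.
rewrite [leLHS]mulrA; apply: ler_wpM2r => //.
have [xA|xA] := leP x A.
  by rewrite mulrC; apply: ler_pM => //; [exact: hat_ge0|exact: hat_le_expR].
rewrite /hat max_l ?mul0r ?mulr_ge0 ?expR_ge0 ?(ltW A0)// subr_le0 ler_pdivlMr// mul1r ltW//.
Qed.

Lemma continuous_fejer A : 0 < A -> continuous (fejer A).
Proof.
move=> A0 y; have [C hC] := fejer_lipschitz A0.
have C0 : 0 <= C.
  by have := le_trans (normr_ge0 _) (hC 1 0); rewrite subr0 normr1 mulr1.
have C1 : 0 < C + 1 by lra.
apply/cvgrPdist_le => e e0.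
near=> z.
apply: le_trans (hC _ _) _.
have : `|y - z| <= e / (C + 1).
  near: z; apply: cvgr_dist_le; first exact: cvg_id.
  exact: divr_gt0.
rewrite ler_pdivlMr// => h; apply: le_trans h.
by rewrite mulrC ler_wpM2l// lerDl.
Unshelve. all: by end_near. Qed.

Definition fejer_mass A e : R := Rintegral mu `[- e, e] (fejer A).

(** Cut off by restriction, so that its integral is still taken over the half-line. A window
    sticking out of it can only lose mass, hence an equality when [e <= z] and an inequality for
    general [z]. *)
Definition fejer_window A e z : R -> R :=
  (fun x => fejer A (x - z)) \_ `[z - e, z + e].

Lemma fejer_windowE A e z x : fejer_window A e z x =
  if (z - e <= x <= z + e) then fejer A (x - z) else 0.
Proof.
by rewrite /fejer_window patchE mem_setE in_itv.
Qed.

Arguments fejer_window : simpl never.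

Let continuous_shift A z : 0 < A -> continuous (fun x => fejer A (x - z)).
Proof.
move=> A0 x; apply: (@continuous_comp _ _ _ (fun x => x - z) (fejer A)).
  by apply: continuousB => //; exact: cst_continuous.
exact: continuous_fejer.
Qed.

Let integrable_shift A z a b : 0 < A ->
  mu.-integrable `[a, b] (EFin \o (fun x => fejer A (x - z))).
Proof.
move=> A0; apply: continuous_compact_integrable; first exact: segment_compact.
exact/continuous_subspaceT/continuous_shift.
Qed.

Let mass_shift A e z : 0 < A -> 0 <= e ->
  Rintegral mu `[z - e, z + e] (fun x => fejer A (x - z)) = fejer_mass A e.
Proof.
move=> A0 e0; rewrite addrC (addrC z).
by rewrite Rintegral_shift//; [lra|exact: continuous_fejer].
Qed.

Lemma integrable_fejer_window A e z : 0 < A -> hintegrable (fejer_window A e z).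
Proof.
move=> A0.
have := @integrable_mkcond _ _ R mu `[z - e, z + e] (EFin \o (fun x => fejer A (x - z)))
  (measurable_itv _).
move=> -[h _].
have {}h := h (integrable_shift _ _ _ A0).
have {h} := @integrableS _ _ R mu _ hl _ measurableT (measurable_itv _) (@subsetT _ _) h.
by apply: eq_integrable => // x _; rewrite /fejer_window /= /patch; case: ifP.
Qed.

Lemma hint_fejer_window A e z : 0 < A -> 0 <= e -> e <= z ->
  hint (fejer_window A e z) = fejer_mass A e.
Proof.
move=> A0 e0 ez; rewrite /fejer_window -Rintegral_mkcondr setIidr ?mass_shift//.
move=> x /=; rewrite !in_itv/= andbT => /andP[+ _]; apply: le_trans; by rewrite subr_ge0.
Qed.

Lemma hint_fejer_window_le A e z : 0 < A -> 0 <= e ->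
  hint (fejer_window A e z) <= fejer_mass A e.
Proof.
move=> A0 e0; rewrite /fejer_window -Rintegral_mkcondr Rintegral_mkcondl -(mass_shift z A0 e0).
apply: le_Rintegral => //; last 2 first.
- exact: integrable_shift.
- by move=> x _; rewrite patchE; case: ifP => // _; exact: fejer_ge0.
have := @integrable_mkcond _ _ R mu hl (EFin \o (fun x => fejer A (x - z)))
  (measurable_itv _).
have h := @integrable_norm _ _ R mu _ _ (integrable_shift z (z - e) (z + e) A0).
move=> _; apply: (le_integrable _ _ _ (integrable_shift z (z - e) (z + e) A0)) => //.
  apply/measurable_EFinP; apply: measurable_funTS; apply/measurable_restrict => //.
  by apply: measurable_funTS; apply: continuous_measurable_fun; exact: continuous_shift.
move=> x _ /=; rewrite lee_fin patchE; case: ifP => // _.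
by rewrite normr0.
Qed.

(** The kernel is at least [A / 4] on an interval of length [2 / A]. A bound independent of [A] and
    [e] makes division by the uncomputed mass harmless. *)
Lemma fejer_mass_ge A e : 0 < A -> A^-1 <= e -> 1 / 2 <= fejer_mass A e.
Proof.
move=> A0 Ae.
have AV0 : 0 < A^-1 by rewrite invr_gt0.
have -> : 1 / 2 = Rintegral mu `[- A^-1, A^-1] (fun=> A / 4).
  rewrite Rintegral_cst//= lebesgue_measure_itv/= lte_fin.
  rewrite ifT; last by lra.
  by rewrite -EFinB /= opprK; field; rewrite gt_eqF.
rewrite (_ : `[- A^-1, A^-1]%classic = `[- e, e] `&` `[- A^-1, A^-1]); last first.
  rewrite setIidr// => x /=; rewrite !in_itv/= => /andP[x1 x2]; apply/andP; split; lra.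
rewrite Rintegral_mkcondr; apply: le_Rintegral => //.
- have : mu.-integrable `[- e, e] (EFin \o (fun x => fejer A x)).
    apply: continuous_compact_integrable; first exact: segment_compact.
    exact/continuous_subspaceT/continuous_fejer.
  move=> /le_integrable; apply => //.
    apply/measurable_EFinP; apply: measurable_funTS; apply/measurable_restrict => //.
  move=> x _ /=; rewrite lee_fin patchE; case: ifPn; last by rewrite normr0.
  rewrite inE/= in_itv/= => /andP[x1 x2].
  rewrite !ger0_norm ?fejer_ge0// ?divr_ge0// ?(ltW A0)//.
  by apply: fejer_near0 => //; rewrite ler_norml x1.
- apply: continuous_compact_integrable; first exact: segment_compact.
  exact/continuous_subspaceT/continuous_fejer.
move=> x _; rewrite patchE; case: ifPn => [|_]; last exact: fejer_ge0.
rewrite inE/= in_itv/= => /andP[x1 x2].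
by apply: fejer_near0 => //; rewrite ler_norml x1.
Qed.

End Fejer.

(** * Smoothing the exponential tail with the Fejer kernel *)

Section LocalLimit.
Context {R : realType}.
Local Notation mu := (@lebesgue_measure R).
Local Notation hl := (`[0, +oo[%classic : set R).
Local Notation hintegrable f := (mu.-integrable hl (EFin \o f)).
Local Notation hint f := (Rintegral mu hl f).

(** Completeness: the centre [l] may vary with [e], so no candidate for the limit has to be
    known. *)
Lemma cvg_squeeze_exists (a : nat -> R) :
  (forall e : R, 0 < e -> exists l : R, \forall n \near \oo, `|a n - l| <= e) ->
  cvgn a.
Proof.
move=> h; apply/cauchy_cvgP/cauchy_exP => e e0.
have [l hl] := h (e / 2) (divr_gt0 e0 (ltr0Sn _ _)).
exists l; apply: filterS hl => n hn; rewrite /ball/= distrC.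
by rewrite (le_lt_trans hn)//; lra.
Qed.

Lemma cvg_invsqrt : (Num.sqrt (n%:R : R))^-1 @[n --> \oo] --> (0 : R).
Proof.
rewrite -(cvg_shiftS _ (nbhs (0 : R))).
have -> : (fun n => (Num.sqrt (n.+1%:R : R))^-1) = Num.sqrt \o (@harmonic R).
  by apply/funext => n; rewrite /= sqrtrV.
have := continuous_cvg _ (@sqrt_continuous R 0) (@cvg_harmonic R).
by rewrite sqrtr0 => /(_ _); apply.
Qed.

(** The convolution of [fejer A] with [tail_exp t]. *)
Definition fejer_exp (t A y : R) := hint (fun b => expR (- t * b) * fejer A (y - b)).

Definition tail_exp (t y : R) : R := if 0 <= y then expR (- t * y) else 0.

Section FejerExp.
Variables t : R.
Hypothesis t0 : 0 < t.

Lemma fejer_bounded (A : R) : 0 < A -> exists C, forall z, fejer A z <= C.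
Proof.
move=> A0; exists (hint (fun x => expR A * expR (- 1 * x))) => z.
rewrite -hint_hat_cos//; apply: le_Rintegral => //.
- exact: integrable_hat_cos.
- exact: integrable_expR_tail.
move=> x; rewrite /= in_itv/= andbT => x0; rewrite mulN1r.
apply: le_trans (hat_le_expR A0 x0).
by rewrite ler_piMr ?hat_ge0// cos_le1.
Qed.

Lemma continuous_expRM : continuous (fun b : R => expR (- t * b)).
Proof.
move=> b; apply: (@continuous_comp _ _ _ (fun b => - t * b) expR); last exact: continuous_expR.
by apply: continuousM => //; exact: cst_continuous.
Qed.

Lemma continuous_fejer_sub A y : 0 < A -> continuous (fun b : R => fejer A (y - b)).
Proof.
move=> A0 b; apply: (@continuous_comp _ _ _ (fun b => y - b) (fejer A)).
  by apply: continuousB => //; exact: cst_continuous.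
exact: continuous_fejer.
Qed.

Lemma continuous_fejer_exp A y : 0 < A ->
  continuous (fun b => expR (- t * b) * fejer A (y - b)).
Proof.
move=> A0 b; apply: (@continuousM _ _ (fun b => expR (- t * b)) (fun b => fejer A (y - b))).
  exact: continuous_expRM.
exact: continuous_fejer_sub.
Qed.

Lemma integrable_fejer_exp A y : 0 < A ->
  hintegrable (fun b => expR (- t * b) * fejer A (y - b)).
Proof.
move=> A0; have [C hC] := fejer_bounded A0.
apply: (@integrable_exp_bound _ _ C t) => //.
  by apply: measurable_funTS; apply: continuous_measurable_fun; exact: continuous_fejer_exp.
move=> x x0; rewrite ger0_norm ?mulr_ge0 ?expR_ge0 ?fejer_ge0// mulrC.
by rewrite ler_wpM2r ?expR_ge0.
Qed.

Lemma fejer_exp_ge0 A y : 0 < A -> 0 <= fejer_exp t A y.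
Proof.
by move=> A0; apply: Rintegral_ge0 => x _; rewrite mulr_ge0 ?expR_ge0 ?fejer_ge0.
Qed.

Lemma fejerN A y : fejer A (- y) = fejer A y :> R.
Proof. by rewrite /fejer oppr_eq0 sqrrN mulrN cosN. Qed.

(** After the shift by [e] the central window is [y <= b <= y + 2 e]. For [0 <= y] it lies in the
    half-line, and there [expR (- t b)] is smaller than [expR (- t y)] by at most the factor
    [expR (- 2 t e)]. The rest of the integral is nonnegative. *)
Lemma fejer_exp_lower A e y : 0 < A -> 0 < e ->
  expR (- (t * (2 * e))) * fejer_mass A e * tail_exp t y <= fejer_exp t A (y + e).
Proof.
move=> A0 e0; rewrite /tail_exp; case: ifPn => [y0|_]; last first.
  by rewrite mulr0 fejer_exp_ge0.
rewrite -(@hint_fejer_window _ A e (y + e))//; [|lra|lra].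
rewrite mulrAC -RintegralZl//; last by exact: integrable_fejer_window.
apply: le_Rintegral => //.
- have := @integrableZl _ _ R mu hl (measurable_itv _)
    (expR (- (t * (2 * e))) * expR (- t * y)) _ (integrable_fejer_window e (y + e) A0).
  by apply: eq_integrable.
- exact: integrable_fejer_exp.
move=> b b0; have {}b0 : 0 <= b by move: b0; rewrite /= in_itv/= andbT.
change (expR (- (t * (2 * e))) * expR (- t * y) * fejer_window A e (y + e) b <=
  expR (- t * b) * fejer A (y + e - b)).
rewrite fejer_windowE; case: ifPn => [|_]; last first.
  by rewrite mulr0 mulr_ge0 ?expR_ge0 ?fejer_ge0.
move=> /andP[b1 b2].
rewrite -(opprB b) fejerN ler_wpM2r ?fejer_ge0// -expRD ler_expR.
have : t * b <= t * (y + 2 * e) by rewrite ler_pM2l//; lra.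
lra.
Qed.

Lemma fejer_tail (A e z : R) : 0 < A -> 0 < e -> e <= `|z| ->
  fejer A z <= (3 + 2 * pi ^+ 2 / e ^+ 2) / A * (fejer 1 z + fejer 1 (z + pi)).
Proof.
move=> A0 e0 ez.
have z0 : 0 < z ^+ 2.
  by rewrite -real_normK ?num_real// exprn_gt0// (lt_le_trans e0).
have ez2 : e ^+ 2 <= z ^+ 2.
  by rewrite -[leRHS]real_normK ?num_real// lerXn2r ?nnegrE// ltW.
have e20 : 0 < e ^+ 2 by rewrite exprn_gt0.
have Az0 : 0 < A * z ^+ 2 by exact: mulr_gt0.
have h1 : fejer A z <= 2 / (A * z ^+ 2).
  rewrite (ler_pdivlMr _ _ Az0) mulrC fejerE//.
  by have := cos_geN1 (A * z); lra.
have f0 := @fejer_ge0 _ 1 z ltr01; have f1 := @fejer_ge0 _ 1 (z + pi) ltr01.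
have h2 : 2 <= (z ^+ 2 + (z + pi) ^+ 2) * (fejer 1 z + fejer 1 (z + pi)).
  have := @fejerE _ 1 z ltr01; have := @fejerE _ 1 (z + pi) ltr01.
  rewrite !mul1r cosDpi => E1 E2.
  have p1 : 0 <= z ^+ 2 * fejer 1 (z + pi) by rewrite mulr_ge0// ltW.
  have p2 : 0 <= (z + pi) ^+ 2 * fejer 1 z by rewrite mulr_ge0// sqr_ge0.
  rewrite mulrDl !mulrDr E1 E2; lra.
have h3 : z ^+ 2 + (z + pi) ^+ 2 <= (3 + 2 * pi ^+ 2 / e ^+ 2) * z ^+ 2.
  have q1 : 2 * pi ^+ 2 <= 2 * pi ^+ 2 / e ^+ 2 * z ^+ 2.
    rewrite -mulrA; apply: ler_peMr; first by rewrite mulr_ge0 ?sqr_ge0.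
    by rewrite mulrC (ler_pdivlMr _ _ e20) mul1r.
  have := sqr_ge0 (z - pi); rewrite mulrDl.
  have -> : (z - pi) ^+ 2 = z ^+ 2 - 2 * z * pi + pi ^+ 2 by ring.
  have -> : (z + pi) ^+ 2 = z ^+ 2 + 2 * z * pi + pi ^+ 2 by ring.
  lra.
apply: le_trans h1 _.
rewrite (ler_pdivrMr _ _ Az0).
apply: le_trans h2 _.
apply: le_trans (ler_wpM2r (addr_ge0 f0 f1) h3) _.
rewrite le_eqVlt; apply/orP; left; apply/eqP; field.
by rewrite !gt_eqF.
Qed.

(** The remainder is again made of [fejer_exp], with kernel parameter [1], so its weighted sums stay
    bounded, while its factor tends to [0] as [A] grows with [e] fixed. *)
Lemma fejer_exp_upper (A e y : R) : 0 < A -> 0 < e ->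
  fejer_exp t A (y - e) <= expR (t * (2 * e)) * fejer_mass A e * tail_exp t y +
    (3 + 2 * pi ^+ 2 / e ^+ 2) / A * (fejer_exp t 1 (y - e) + fejer_exp t 1 (y - e + pi)).
Proof.
move=> A0 e0; set c := (3 + _) / A; set z := y - e.
have c0 : 0 <= c.
  apply: divr_ge0; last exact: ltW.
  by apply: addr_ge0 => //; apply: divr_ge0; [apply: mulr_ge0 => //|]; exact: sqr_ge0.
have tl0 : 0 <= tail_exp t y by rewrite /tail_exp; case: ifP => // _; exact: expR_ge0.
pose g b := expR (t * (2 * e)) * tail_exp t y * fejer_window A e z b.
pose k b := c * (expR (- t * b) * fejer 1 (z - b) + expR (- t * b) * fejer 1 (z + pi - b)).
have ig : hintegrable g.
  have := @integrableZl _ _ R mu hl (measurable_itv _)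
    (expR (t * (2 * e)) * tail_exp t y) _ (integrable_fejer_window e z A0).
  by apply: eq_integrable.
have i1 := @integrable_fejer_exp 1 z ltr01.
have i2 := @integrable_fejer_exp 1 (z + pi) ltr01.
have i12 : hintegrable (fun b => expR (- t * b) * fejer 1 (z - b) + expR (- t * b) * fejer 1 (z + pi - b)).
  have := @integrableD _ _ R mu hl (measurable_itv _) _ _ i1 i2.
  by apply: eq_integrable.
have ik : hintegrable k.
  have := @integrableZl _ _ R mu hl (measurable_itv _) c _ i12.
  by apply: eq_integrable.
apply: (@le_trans _ _ (hint (fun b => g b + k b))); last first.
  rewrite RintegralD// lerD//.
    rewrite RintegralZl//; last exact: integrable_fejer_window.
    rewrite mulrAC -mulrA -[leRHS]mulrA ler_wpM2l ?expR_ge0// ler_wpM2r//.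
      by apply: hint_fejer_window_le => //; exact: ltW.
  by rewrite RintegralZl// RintegralD//.
apply: le_Rintegral => //.
- exact: integrable_fejer_exp.
- have := @integrableD _ _ R mu hl (measurable_itv _) _ _ ig ik.
  by apply: eq_integrable.
move=> b b0; have {}b0 : 0 <= b by move: b0; rewrite /= in_itv/= andbT.
have k0 : 0 <= k b by rewrite mulr_ge0// -mulrDr mulr_ge0 ?expR_ge0// addr_ge0// fejer_ge0.
have g0 : 0 <= g b.
  rewrite mulr_ge0 ?mulr_ge0 ?expR_ge0// fejer_windowE; case: ifP => // _.
  exact: fejer_ge0.
(* Inside the window [y - 2 e <= b <= y], so [0 <= b] forces [0 <= y] and [tail_exp t y] is the
   exponential; outside, [fejer_tail] applies. *)
have [zb|zb] := leP `|z - b| e.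
  apply: ler_wpDr => //.
  move: zb; rewrite ler_norml => /andP[z1 z2].
  rewrite /g fejer_windowE ifT; last by apply/andP; split; lra.
  rewrite -(opprB b) fejerN ler_wpM2r ?fejer_ge0//.
  rewrite /tail_exp ifT; last by rewrite /z in z1 z2 *; lra.
  rewrite -expRD ler_expR.
  have : t * (y - 2 * e) <= t * b by rewrite ler_pM2l//; rewrite /z in z1 z2 *; lra.
  lra.
apply: ler_wpDl => //.
rewrite /k -mulrDr mulrCA ler_wpM2l ?expR_ge0//.
have -> : z + pi - b = (z - b) + pi by ring.
by apply: fejer_tail => //; exact: ltW.
Qed.

End FejerExp.
End LocalLimit.

(** * A local limit theorem for exponential tails *)

Section Sandwich.
Variable R : realFieldType.

(** Here [x] is the squeezed quantity, [z] and [y] are the two smoothed sums with common limit [v],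
    [k] is the kernel mass and [q] the loss from the shifts. The inequalities place [k x] within
    [eps / 2] of [v], and [1 / 2 <= k] allows dividing by [k]. *)
Lemma sandwich_dist_le (x y z v d k q eps : R) : 0 < d -> d = eps / 12 -> 1 / 2 <= k ->
  0 < q -> 1 <= q -> q <= 2 -> `|(q - 1) * v| <= eps / 8 ->
  `|v - z| <= d -> `|v - y| <= d ->
  q^-1 * k * x <= z -> y <= q * k * x + d -> `|x - v / k| <= eps.
Proof.
move=> d0 d12 k0 q0 q1 q2 qv n1 n2 b2 b1.
have k00 : 0 < k by lra.
move: qv n1 n2; rewrite !ler_norml => /andP[v1 v2] /andP[n1 n1'] /andP[n2 n2'].
have u1 : k * x <= q * (v + d).
  rewrite -ler_pdivrMl// mulrA (le_trans b2)//; lra.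
have u2 : v - 2 * d <= q * (k * x) by rewrite mulrA; lra.
have qd : q * d <= 2 * d by apply: ler_wpM2r; [exact: ltW|lra].
have w1 : k * x - v <= eps / 2 by lra.
have w2 : v - k * x <= eps / 2.
  have [vk|vk] := leP v (k * x); first by lra.
  have : v - k * x <= q * (v - k * x) by rewrite ler_peMl// subr_ge0 ltW.
  lra.
have keps : eps / 2 <= eps * k by apply: ler_wpM2l; lra.
have xE : k * (v / k) = v by rewrite mulrCA divff ?mulr1// gt_eqF.
apply/andP; split; rewrite -(ler_pM2l k00) ?mulrBr ?xE; lra.
Qed.

End Sandwich.

Section LocalLimitTheorem.
Context {R : realType} (X : nat -> finType) (w T : forall n, X n -> R).
Arguments w : clear implicits.
Arguments T : clear implicits.
Local Notation mu := (@lebesgue_measure R).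
Local Notation hl := (`[0, +oo[%classic : set R).
Local Notation hintegrable f := (mu.-integrable hl (EFin \o f)).
Local Notation hint f := (Rintegral mu hl f).
Variable psi : R -> R.
Hypothesis w0 : forall n x, 0 <= w n x.
(** Cosine transforms suffice because the kernel is itself a cosine transform. The decay is uniform
    in the shift [b], which is integrated over the half-line later, but only local in the frequency
    [s]. *)
Hypothesis char_decay : forall A : R, 0 < A -> exists C c : R, [/\ 0 <= C, 0 < c &
  forall n (b s : R), 0 <= s -> s <= A ->
  `|\sum_x w n x * cos (s * (T n x - b))| <= C * expR (- c * s ^+ 2 * n%:R)].
Hypothesis char_cvg : forall u b : R, 0 <= u ->
  \sum_x w n x * cos (u * ((T n x - b) / Num.sqrt n%:R)) @[n --> \oo] --> psi u.

Let W (A : R) n (b : R) : R := Num.sqrt n%:R * \sum_x w n x * fejer A (T n x - b).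

(** The frequency integrand of [W A n b] after the substitution [s = u / sqrt n]. *)
Let f_ (A b : R) n (u : R) : R := hat (A * Num.sqrt n%:R) u *
  \sum_x w n x * cos (u * ((T n x - b) / Num.sqrt n%:R)).

Let sqrt_gt0 n : 0 < Num.sqrt (n.+1%:R : R). Proof. by rewrite sqrtr_gt0. Qed.

Let f_E (A b : R) n (u : R) : f_ A b n u =
  \sum_x w n x * (hat (A * Num.sqrt n%:R) u * cos (u * ((T n x - b) / Num.sqrt n%:R))).
Proof. by rewrite /f_ mulr_sumr; apply: eq_bigr => x _; rewrite mulrCA. Qed.

Let W_hint (A b : R) n : 0 < A -> W A n.+1 b = hint (f_ A b n.+1).
Proof.
move=> A0; have An0 := mulr_gt0 A0 (sqrt_gt0 n).
have -> : f_ A b n.+1 = (fun u => \sum_x w n.+1 x *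
   (hat (A * Num.sqrt n.+1%:R) u * cos (u * ((T n.+1 x - b) / Num.sqrt n.+1%:R)))).
  by apply/funext => u; rewrite f_E.
have [|_ ->] := hint_sum (w n.+1) (F := fun x u => hat (A * Num.sqrt n.+1%:R) u *
    cos (u * ((T n.+1 x - b) / Num.sqrt n.+1%:R))).
  by move=> x; exact: integrable_hat_cos.
rewrite /W mulr_sumr; apply: eq_bigr => x _.
by rewrite hint_hat_cos// fejer_scale// mulrCA.
Qed.

Let f_bound (A : R) : 0 < A -> exists C c : R, [/\ 0 <= C, 0 < c & forall (b : R) n (u : R), 0 <= u ->
  `|f_ A b n.+1 u| <= C * expR (- c * u)].
Proof.
move=> A0; have [C [c [C0 c0 H]]] := char_decay A0.
(* The Gaussian bound is weakened to an exponential one by [- c u^2 <= c - 2 c u], that is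
   [0 <= c (u - 1)^2]. *)
exists (C * expR c), (2 * c); split => [||b n u u0]; rewrite ?mulr_ge0 ?expR_ge0 ?mulr_gt0//.
have An0 := mulr_gt0 A0 (sqrt_gt0 n).
(* The hat vanishes exactly where [u / sqrt n] leaves the range of [char_decay]. *)
have [uA|uA] := leP u (A * Num.sqrt n.+1%:R); last first.
  rewrite /f_ /hat max_l ?mul0r ?normr0 ?mulr_ge0 ?expR_ge0//.
  by rewrite subr_le0 ler_pdivlMr// mul1r ltW.
rewrite /f_ normrM (ger0_norm (hat_ge0 _ _)).
rewrite -[leRHS]mul1r ler_pM ?hat_ge0 ?hat_le1//.
have s0 : 0 <= u / Num.sqrt n.+1%:R by rewrite divr_ge0.
have sA : u / Num.sqrt n.+1%:R <= A by rewrite ler_pdivrMr.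
have := H n.+1 b _ s0 sA.
have -> : - c * (u / Num.sqrt n.+1%:R) ^+ 2 * n.+1%:R = - c * u ^+ 2.
  by rewrite expr_div_n sqr_sqrtr// -mulrA divfK// pnatr_eq0.
under eq_bigr do rewrite -mulrA (mulrC (_^-1)).
move=> h; apply: le_trans h _; rewrite -mulrA ler_wpM2l// -expRD ler_expR.
have : 0 <= c * (u - 1) ^+ 2 by rewrite mulr_ge0 ?sqr_ge0// ltW.
have -> : (u - 1) ^+ 2 = u ^+ 2 - 2 * u + 1 by ring.
lra.
Qed.

Let measurable_f (A b : R) n : measurable_fun hl (f_ A b n).
Proof.
have -> : f_ A b n = (fun u => \sum_x w n x *
   (hat (A * Num.sqrt n%:R) u * cos (u * ((T n x - b) / Num.sqrt n%:R)))).
  by apply/funext => u; rewrite f_E.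
apply: measurable_sum => x; apply: measurable_funTS; apply: continuous_measurable_fun => u.
by apply: cvgM; [exact: cvg_cst|exact: continuous_hat_cos].
Qed.

Let hat_cvg (A u : R) : 0 < A -> hat (A * Num.sqrt n%:R) u @[n --> \oo] --> (1 : R).
Proof.
move=> A0.
have h : (1 - u / (A * Num.sqrt n%:R)) @[n --> \oo] --> (1 : R).
  rewrite -[X in _ --> X]subr0; apply: cvgB; first exact: cvg_cst.
  have -> : (fun n => u / (A * Num.sqrt n%:R)) =
     (fun n => u / A * (Num.sqrt (n%:R : R))^-1).
    by apply/funext => n; rewrite invfM mulrA.
  rewrite -[X in _ --> X](mulr0 (u / A)); apply: cvgM; first exact: cvg_cst.
  exact: cvg_invsqrt.
have hm : {for 1, continuous (fun y : R => Num.max 0 y)}.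
  apply: (@continuous_max _ _ (fun=> 0) (fun y : R => y)); first exact: cst_continuous.
  exact: cvg_id.
have := continuous_cvg _ hm h => /(_ _).
by rewrite max_r//; apply.
Qed.

Let kappa := hint psi.

Let W_cvg (A b : R) : 0 < A -> W A n b @[n --> \oo] --> kappa.
Proof.
move=> A0; rewrite -(cvg_shiftS _ (nbhs kappa)).
have [C [c [C0 c0 H]]] := f_bound A0.
have -> : (fun n => W A n.+1 b) = (fun n => hint (f_ A b n.+1)).
  by apply/funext => n; rewrite W_hint.
apply: (@hint_cvg _ (fun n => f_ A b n.+1) psi C c) => // [n u|u u0]; first exact: H.
have h : f_ A b n u @[n --> \oo] --> 1 * psi u.
  by apply: cvgM; [exact: hat_cvg|exact: char_cvg].
by move: h; rewrite mul1r -(cvg_shiftS _ (nbhs (psi u))).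
Qed.

(** Uniformity in [b] provides the majorant for integrating over the shift. *)
Let W_bound (A : R) : 0 < A -> exists2 C : R, 0 <= C & forall n b, `|W A n b| <= C.
Proof.
move=> A0; have [C [c [C0 c0 H]]] := f_bound A0.
have i0 := integrable_expR_tail C c0.
have h0 : 0 <= hint (fun u => C * expR (- c * u)).
  by apply: Rintegral_ge0 => u _; rewrite mulr_ge0 ?expR_ge0.
exists (hint (fun u => C * expR (- c * u))) => // -[|n] b.
  by rewrite /W sqrtr0 mul0r normr0.
rewrite W_hint//.
have iF : hintegrable (f_ A b n.+1).
  by apply: (integrable_exp_bound c0) => //; exact: H.
apply: (le_trans (@le_normr_Rintegral _ _ R mu hl _ (measurable_itv _) iF)).
apply: le_Rintegral => //.
- by have := @integrable_norm _ _ R mu hl _ iF; apply: eq_integrable.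
- by move=> u; rewrite /= in_itv/= andbT; exact: H.
Qed.

Section Exponent.
Variables t : R.
Hypothesis t0 : 0 < t.

Let V (A : R) n (s : R) : R := Num.sqrt n%:R * \sum_x w n x * fejer_exp t A (T n x - s).

(** The smoothed tail sum is an exponential average of shifted kernel sums; only a finite sum is
    exchanged with the integral. *)
Let V_hint (A : R) n (s : R) : 0 < A ->
  V A n s = hint (fun b => expR (- t * b) * W A n (s + b)).
Proof.
move=> A0.
have -> : (fun b => expR (- t * b) * W A n (s + b)) =
  (fun b => Num.sqrt n%:R * \sum_x w n x * (expR (- t * b) * fejer A (T n x - s - b))).
  apply/funext => b; rewrite /W mulrCA mulr_sumr; congr *%R.
  by apply: eq_bigr => x _; rewrite mulrCA opprD addrA.
have [|h1 h2] := hint_sum (w n) (F := fun x b => expR (- t * b) * fejer A (T n x - s - b)).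
  by move=> x; exact: integrable_fejer_exp.
by rewrite RintegralZl// h2.
Qed.

Let measurable_W (A : R) n (s : R) : 0 < A ->
  measurable_fun hl (fun b => expR (- t * b) * W A n (s + b)).
Proof.
move=> A0.
have -> : (fun b => expR (- t * b) * W A n (s + b)) =
  (fun b => Num.sqrt n%:R * \sum_x w n x * (expR (- t * b) * fejer A (T n x - s - b))).
  apply/funext => b; rewrite /W mulrCA mulr_sumr; congr *%R.
  by apply: eq_bigr => x _; rewrite mulrCA opprD addrA.
apply: measurable_funM; first exact: measurable_cst.
apply: measurable_sum => x; apply: measurable_funTS; apply: continuous_measurable_fun => b.
by apply: cvgM; [exact: cvg_cst|exact: continuous_fejer_exp].
Qed.

Let v := hint (fun b => expR (- t * b) * kappa).

Let V_cvg (A s : R) : 0 < A -> V A n s @[n --> \oo] --> v.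
Proof.
move=> A0; have [C C0 H] := W_bound A0.
have -> : V A ^~ s = (fun n => hint (fun b => expR (- t * b) * W A n (s + b))).
  by apply/funext => n; rewrite V_hint.
apply: (hint_cvg (C := C) t0) => [n|n b b0|b b0].
- exact: measurable_W.
- by rewrite normrM ger0_norm ?expR_ge0// mulrC ler_wpM2r ?expR_ge0.
- by apply: cvgM; [exact: cvg_cst|exact: W_cvg].
Qed.

Let V_bound : exists2 C : R, 0 <= C & forall n s, `|V 1 n s| <= C.
Proof.
have [C C0 H] := W_bound ltr01.
exists (hint (fun b => C * expR (- t * b))) => [|n s].
  by apply: Rintegral_ge0 => u _; rewrite mulr_ge0 ?expR_ge0.
rewrite V_hint//.
have hb b : `|expR (- t * b) * W 1 n (s + b)| <= C * expR (- t * b).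
  by rewrite normrM ger0_norm ?expR_ge0// mulrC ler_wpM2r ?expR_ge0.
have iF : hintegrable (fun b => expR (- t * b) * W 1 n (s + b)).
  by apply: (integrable_exp_bound (C := C) t0) => //; exact: measurable_W.
apply: (le_trans (@le_normr_Rintegral _ _ R mu hl _ (measurable_itv _) iF)).
apply: le_Rintegral => //.
- by have := @integrable_norm _ _ R mu hl _ iF; apply: eq_integrable.
- exact: integrable_expR_tail.
Qed.

Let a n : R := Num.sqrt n%:R * \sum_x w n x * tail_exp t (T n x).

Let a_le (A e : R) n : 0 < A -> 0 < e ->
  expR (- (t * (2 * e))) * fejer_mass A e * a n <= V A n (- e).
Proof.
move=> A0 e0; rewrite /a /V mulrCA ler_wpM2l ?sqrtr_ge0// mulr_sumr ler_sum// => x _.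
by rewrite mulrCA ler_wpM2l// opprK fejer_exp_lower.
Qed.

Let a_ge (A e : R) n : 0 < A -> 0 < e ->
  V A n e <= expR (t * (2 * e)) * fejer_mass A e * a n +
    (3 + 2 * pi ^+ 2 / e ^+ 2) / A * (V 1 n e + V 1 n (e - pi)).
Proof.
move=> A0 e0; rewrite /a /V -mulrDr -big_split/= mulrCA (mulrCA _ (Num.sqrt _)) -mulrDr.
rewrite ler_wpM2l ?sqrtr_ge0// !mulr_sumr -big_split/= ler_sum// => x _.
rewrite -mulrDr mulrCA (mulrCA _ (w n x)) -mulrDr ler_wpM2l//.
have -> : T n x - (e - pi) = T n x - e + pi by rewrite opprB addrA addrAC.
exact: fejer_exp_upper.
Qed.

Theorem local_limit_exp_tail :
  cvgn (fun n => Num.sqrt n%:R * \sum_x w n x * tail_exp t (T n x)).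
Proof.
apply: cvg_squeeze_exists => eps eps0.
have [C C0 HC] := V_bound.
have v0 : 0 <= `|v| by [].
pose d := eps / 12.
have d0 : 0 < d by rewrite divr_gt0.
(* [v] does not depend on [A] or [e], so the loss [h = 2 t e] can be tuned to [v] first, and [A]
   chosen last, in terms of [e]. *)
pose h := Num.min (1 / 2) (eps / (8 * (2 * (`|v| + 1)))).
have h0 : 0 < h by rewrite lt_min !divr_gt0// !mulr_gt0// ltr_wpDl.
pose e := h / (2 * t).
have e0 : 0 < e by rewrite divr_gt0// mulr_gt0.
have te : t * (2 * e) = h by rewrite /e; field; rewrite gt_eqF.
pose c0 : R := 3 + 2 * pi ^+ 2 / e ^+ 2.
have c00 : 0 <= c0.
  by apply: addr_ge0 => //; apply: divr_ge0; [apply: mulr_ge0 => //|]; exact: sqr_ge0.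
(* The first summand makes the kernel mass at least [1 / 2], the second brings the tail term below
   [d]. *)
pose A := e^-1 + c0 * (2 * C) / d.
have A0 : 0 < A by rewrite ltr_wpDr ?invr_gt0// divr_ge0 ?(ltW d0)// !mulr_ge0.
have Ae : A^-1 <= e.
  rewrite -[leRHS]invrK lef_pV2 ?posrE ?invr_gt0// lerDl divr_ge0 ?(ltW d0)// !mulr_ge0//.
have rd : c0 / A * (2 * C) <= d.
  rewrite mulrAC ler_pdivrMr// [leRHS]mulrC -ler_pdivrMr// /A lerDr invr_ge0 ltW//.
have k0 := fejer_mass_ge A0 Ae.
set k := fejer_mass A e in k0.
pose q := expR h.
have q1 : 1 <= q by rewrite -expR0 ler_expR ltW.
have hh : h <= 1 / 2 by rewrite /h ge_min lexx.
have q2 : q <= 1 + 2 * h.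
  have := @expR_le_quad _ h; rewrite ger0_norm ?(ltW h0)// => /(_ hh) qh.
  by apply: le_trans qh _; nra.
have hv : h * `|v| <= eps / 16.
  have : h <= eps / (8 * (2 * (`|v| + 1))) by rewrite /h ge_min lexx orbT.
  rewrite ler_pdivlMr ?mulr_gt0// ?ltr_wpDl//; nra.
have qv : `|(q - 1) * v| <= eps / 8.
  rewrite normrM ger0_norm ?subr_ge0//.
  have : (q - 1) * `|v| <= (2 * h) * `|v| by rewrite ler_wpM2r//; lra.
  lra.
have q0 : 0 < q by exact: expR_gt0.
have near1 : \forall n \near \oo, `|v - V A n (- e)| <= d.
  by have /cvgrPdist_le := V_cvg (- e) A0; apply.
have near2 : \forall n \near \oo, `|v - V A n e| <= d.
  by have /cvgrPdist_le := V_cvg e A0; apply.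
(* An approximate limit only: [k] depends on [A] and [e], hence on [eps]. *)
exists (v / k).
near=> n.
have n1 : `|v - V A n (- e)| <= d by near: n.
have n2 : `|v - V A n e| <= d by near: n.
have := a_le n A0 e0; have := a_ge n A0 e0.
rewrite expRN te -/k -/q -/c0 => b1 b2.
change (`|a n - v / k| <= eps).
move: (a n) (V A n e) (V A n (- e)) n1 n2 b1 b2 => x y z n1 n2 b1 b2.
have b3 : c0 / A * (V 1 n e + V 1 n (e - pi)) <= d.
  apply: le_trans rd; apply: ler_wpM2l; first by rewrite divr_ge0// ltW.
  have := ler_norm (V 1 n e); have := ler_norm (V 1 n (e - pi)).
  have := HC n e; have := HC n (e - pi); lra.
apply: (@sandwich_dist_le _ x y z v d k q) => //; [lra|].
by rewrite (le_trans b1)// lerD2l.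
Unshelve. all: by end_near. Qed.

End Exponent.
End LocalLimitTheorem.

(** * Positive matrices *)

Definition mxop (K : nzSemiRingType) (I : finType) (W : I -> I -> K) (g : I -> K) : I -> K :=
  fun j => \sum_k W j k * g k.

Section FiniteExtrema.
Context {R : realDomainType} (I : finType) (i0 : I).

Lemma ex_argmax (f : I -> R) : exists i, forall j, f j <= f i.
Proof. by case: (arg_maxP (i0 := i0) (P := xpredT) f) => // i _ h; exists i => j; exact: h. Qed.

Lemma ex_argmin (f : I -> R) : exists i, forall j, f i <= f j.
Proof. by case: (arg_minP (i0 := i0) (P := xpredT) f) => // i _ h; exists i => j; exact: h. Qed.

End FiniteExtrema.

Section PositiveMatrices.
Context {R : realType} (d : nat) (i0 : 'I_d).
Implicit Types (M Q : 'I_d -> 'I_d -> R) (u v x f : 'I_d -> R).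

(** A row vector of length [d + 1] encodes a pair: coordinate [ord0] is a candidate eigenvalue, the
    others a probability vector, so that maximizing the eigenvalue is maximizing a coordinate on a
    compact set. *)
Let compact_subeigen M (L : R) : compact [set y : 'rV[R]_d.+1 |
   (forall i, `[0, L] (y ord0 i)) /\ \sum_i y ord0 (lift ord0 i) = 1 /\
   forall i, y ord0 ord0 * y ord0 (lift ord0 i) <= mxop M (fun k => y ord0 (lift ord0 k)) i].
Proof.
have cc i : continuous (fun y : 'rV[R]_d.+1 => y ord0 i) by exact: coord_continuous.
pose B := [set v : 'rV[R]_d.+1 | forall i, `[0, L]%classic (v ord0 i)].
have cB : compact B.
  apply: (@rV_compact _ d.+1 (fun=> `[0, L]%classic)) => _; exact: segment_compact.
apply: (subclosed_compact _ cB); last by move=> y [].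
have clB : closed B.
  have -> : B = \bigcap_(i in [set: 'I_d.+1])
      (fun y : 'rV[R]_d.+1 => y ord0 i) @^-1` `[0, L].
    by apply/seteqP; split => y /= h i => [_|]; exact: h.
  apply: closed_bigI => i _; apply: preimage_closed; first by move=> y _; exact: cc.
  exact: interval_closed.
have csum : continuous (fun y : 'rV[R]_d.+1 => \sum_i y ord0 (lift ord0 i)).
  by apply: continuous_big => [|i _]; [exact: add_continuous|exact: cc].
have cl1 : closed [set y : 'rV[R]_d.+1 | \sum_i y ord0 (lift ord0 i) = 1].
  by apply: (@preimage_closed _ _ (fun y : 'rV[R]_d.+1 => \sum_i y ord0 (lift ord0 i)) [set 1]).
have cl2 : closed (\bigcap_(i in [set: 'I_d]) [set y : 'rV[R]_d.+1 |
    0 <= mxop M (fun k => y ord0 (lift ord0 k)) i - y ord0 ord0 * y ord0 (lift ord0 i)]).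
  apply: closed_bigI => i _.
  apply: (@preimage_closed _ _ (fun y : 'rV[R]_d.+1 => mxop M (fun k => y ord0 (lift ord0 k)) i -
    y ord0 ord0 * y ord0 (lift ord0 i)) [set x | 0 <= x]); last exact: closed_ge.
  move=> y _; apply: (@continuousB _ _ _ (fun y : 'rV[R]_d.+1 => mxop M (fun k => y ord0 (lift ord0 k)) i)
    (fun y => y ord0 ord0 * y ord0 (lift ord0 i))).
    apply: continuous_big => [|k _]; first exact: add_continuous.
    move=> z; apply: (@continuousM R _ (fun _ : 'rV[R]_d.+1 => M i k) (fun y : 'rV[R]_d.+1 => y ord0 (lift ord0 k))).
      exact: cst_continuous.
    exact: cc.
  apply: (@continuousM _ _ (fun y : 'rV[R]_d.+1 => y ord0 ord0) (fun y => y ord0 (lift ord0 i))); exact: cc.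
have := closedI clB (closedI cl1 cl2).
congr closed; apply/seteqP; split => y /=.
  by move=> [h1 [h2 h3]]; split => //; split => // i; rewrite -subr_ge0; exact: h3.
by move=> [h1 [h2 h3]]; split => //; split => // i _ /=; rewrite subr_ge0.
Qed.

Lemma mxop_ge0 M u j : (forall j k, 0 <= M j k) -> (forall j, 0 <= u j) -> 0 <= mxop M u j.
Proof. by move=> M0 u0; apply: sumr_ge0 => k _; rewrite mulr_ge0. Qed.

Lemma mxop_gt0 M u i j : (forall j k, 0 < M j k) -> (forall j, 0 <= u j) -> 0 < u i ->
  0 < mxop M u j.
Proof.
move=> M0 u0 ui; rewrite /mxop (bigD1 i)//= ltr_pwDl ?mulr_gt0//.
by apply: sumr_ge0 => k _; rewrite mulr_ge0// ltW.
Qed.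

(* Collatz-Wielandt: [lam] is the largest number such that [lam x <= M x] for some
   probability vector [x]; at a maximizer, [M x - lam x != 0] would give
   [M (M x) > lam (M x)] coordinatewise. *)
Lemma perron M : (forall j k, 0 < M j k) ->
  exists (lam : R) u, [/\ 0 < lam, forall j, 0 < u j & forall j, mxop M u j = lam * u j].
Proof.
move=> M0; have M0' j k : 0 <= M j k by rewrite ltW.
(* One bound for all coordinates: entries of a probability vector are at most [1], and summing
   [l x <= M x] bounds [l] by the sum of all entries of [M]. *)
pose L := 1 + \sum_j \sum_k M j k.
have S0 : 0 <= \sum_j \sum_k M j k by apply: sumr_ge0 => j _; apply: sumr_ge0.
set K := [set y : 'rV[R]_d.+1 | (forall i, `[0, L] (y ord0 i)) /\
  \sum_i y ord0 (lift ord0 i) = 1 /\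
  forall i, y ord0 ord0 * y ord0 (lift ord0 i) <= mxop M (fun k => y ord0 (lift ord0 k)) i].
have cK : compact K by exact: compact_subeigen.
have inK (l : R) x : 0 <= l -> (forall i, 0 <= x i) -> 0 < \sum_i x i ->
    (forall i, l * x i <= mxop M x i) ->
    exists2 y, K y & y ord0 ord0 = l.
  move=> l0 x0 s0 lx.
  pose s := \sum_i x i.
  have xs i : x i / s <= 1.
    rewrite ler_pdivrMr// mul1r /s (bigD1 i)//= lerDl; exact: sumr_ge0.
  exists (\row_i if unlift ord0 i is Some k then x k / s else l);
    last by rewrite mxE unlift_none.
  have E i : (\row_i if unlift ord0 i is Some k then x k / s else l) ord0 (lift ord0 i)
      = x i / s by rewrite mxE liftK.
  split; last split.
  - move=> i; rewrite mxE /= in_itv/=; case: unliftP => [k _|_].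
      by rewrite divr_ge0 ?(ltW s0)//= (le_trans (xs k))// lerDl.
    rewrite l0/=; have : l * s <= \sum_j \sum_k M j k * s.
      rewrite /s mulr_sumr ler_sum// => i' _; apply: le_trans (lx i') _.
      apply: ler_sum => k _; rewrite ler_wpM2l// (bigD1 k)//= lerDl; exact: sumr_ge0.
    have -> : \sum_j \sum_k M j k * s = (\sum_j \sum_k M j k) * s.
      by rewrite mulr_suml; apply: eq_bigr => j _; rewrite mulr_suml.
    by rewrite ler_pM2r// => h; rewrite (le_trans h)// lerDr.
  - under eq_bigr do rewrite E; rewrite -mulr_suml divff// gt_eqF//.
  - move=> i; rewrite E mxE unlift_none.
    have -> : mxop M (fun k => (\row_i if unlift ord0 i is Some k then x k / s else l)
        ord0 (lift ord0 k)) i = mxop M x i / s.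
      by rewrite /mxop mulr_suml; apply: eq_bigr => k _; rewrite E mulrA.
    by rewrite mulrA ler_pM2r// invr_gt0.
have [||y /set_mem[y1 [y2 y3]] ymax] := @compact_EVT_max _ R (fun y : 'rV[R]_d.+1 => y ord0 ord0) K _ cK.
- have [||||y Ky _] := inK 0 (fun=> 1) => //.
  + by rewrite sumr_const card_ord ltr0n; case: (d) i0 => // -[].
  + by move=> i; rewrite mul0r mxop_ge0.
  + by exists y.
- exact/continuous_subspaceT/coord_continuous.
set l := y ord0 ord0 in y3 ymax.
pose x i := y ord0 (lift ord0 i).
have x0 i : 0 <= x i by have := y1 (lift ord0 i); rewrite /= in_itv/= => /andP[].
have l0 : 0 <= l by have := y1 ord0; rewrite /= in_itv/= => /andP[].
have [i xi] : exists i, 0 < x i.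
  apply/not_existsP => h; have : \sum_i x i = 0.
    by apply: big1 => i _; apply/eqP; rewrite eq_le x0 andbT leNgt; apply/negP; exact: h.
  by rewrite y2 => /eqP; rewrite oner_eq0.
have Mx0 j : 0 < mxop M x j by exact: (mxop_gt0 (i := i)).
have eqx j : mxop M x j = l * x j.
  apply/eqP; rewrite eq_le y3 andbT leNgt; apply/negP => lj.
  pose z k := mxop M x k - l * x k.
  have z0 k : 0 <= z k by rewrite subr_ge0; exact: y3.
  have zj : 0 < z j by rewrite subr_gt0.
  have Mz0 k : 0 < mxop M z k by exact: (mxop_gt0 (i := j)).
  have [k hk] := ex_argmin i0 (fun k => mxop M z k / mxop M x k).
  pose e := mxop M z k / mxop M x k.
  have e0 : 0 < e by rewrite divr_gt0.
  have [||||y' Ky' y'l] := inK (l + e) (mxop M x).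
  - by rewrite addr_ge0// ltW.
  - by move=> k'; rewrite ltW.
  - by rewrite (bigD1 i)//= ltr_pwDl// sumr_ge0// => k' _; rewrite ltW.
  - move=> k'; rewrite mulrDl -lerBrDl.
    have -> : mxop M (mxop M x) k' - l * mxop M x k' = mxop M z k'.
      rewrite /z [in RHS]/mxop; under [RHS]eq_bigr do rewrite mulrBr mulrCA.
      by rewrite sumrB -mulr_sumr.
    by rewrite -ler_pdivlMr.
  have := ymax y' (mem_set Ky').
  by rewrite y'l leNgt ltrDl e0.
have lx k : 0 < l * x k by rewrite -eqx.
exists l, x; split => //.
  rewrite lt_def l0 andbT; apply/eqP => l00; have := lx i0; by rewrite l00 mul0r ltxx.
move=> k; rewrite lt_def x0 andbT; apply/eqP => x00; have := lx k; by rewrite x00 mulr0 ltxx.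
Qed.

(** Where [u / v] is maximal, [u] touches a multiple of [v] lying above it; applying [M] to both
    compares the eigenvalues. Every upper bound on [Lambda] below comes from such a test vector
    [v]. *)
Lemma collatz_wielandt_le M lam rho u v : (forall j k, 0 <= M j k) ->
  (forall j, 0 < u j) -> (forall j, mxop M u j = lam * u j) ->
  (forall j, 0 < v j) -> (forall j, mxop M v j <= rho * v j) -> lam <= rho.
Proof.
move=> M0 u0 Mu v0 Mv.
have [i hi] := ex_argmax i0 (fun i => u i / v i).
have h j : u j <= u i / v i * v j by rewrite -ler_pdivrMr.
have uv0 : 0 < u i / v i by rewrite divr_gt0.
have : lam * u i <= u i / v i * (rho * v i).
  rewrite -Mu; apply: (@le_trans _ _ (u i / v i * mxop M v i)); last by rewrite ler_pM2l.
  rewrite /mxop mulr_sumr; apply: ler_sum => k _; rewrite mulrCA ler_wpM2l//.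
have -> : u i / v i * (rho * v i) = rho * u i by rewrite mulrCA divfK// gt_eqF.
by rewrite ler_pM2r.
Qed.

Lemma mxop_harmonic_cst Q x : (forall j k, 0 < Q j k) -> (forall j, \sum_k Q j k = 1) ->
  (forall j, mxop Q x j = x j) -> forall j, x j = x i0.
Proof.
move=> Q0 Q1 Qx.
have [i hi] := ex_argmax i0 x.
suff h j : x j = x i by move=> j; rewrite !h.
have : \sum_k Q i k * (x i - x k) = 0.
  by under eq_bigr do rewrite mulrBr; rewrite sumrB -mulr_suml Q1 mul1r [X in _ - X]Qx subrr.
move/eqP; rewrite psumr_eq0 => [/allP/(_ j)|k _]; last by rewrite mulr_ge0 ?subr_ge0// ltW.
rewrite mem_index_enum => /(_ isT); rewrite /= mulf_eq0 gt_eqF//= subr_eq0.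
by move=> /eqP.
Qed.

(** The constant [m] is the stationary mean of [f]. Injectivity is a maximum principle: at a maximum
    of [v] the equation gives [v i0 <= 0], at a minimum [0 <= v i0]; then [v] is harmonic, so
    constant and equal to [v i0 = 0]. *)
Lemma poisson_equation Q f : (forall j k, 0 < Q j k) -> (forall j, \sum_k Q j k = 1) ->
  exists m x, forall j, f j = m + x j - mxop Q x j.
Proof.
move=> Q0 Q1.
(* [I - Q] plus the rank-one map sending [v] to the constant function [v i0], transposed to act on
   row vectors. The added term removes the constants from the kernel, and [m] is read off as
   [x i0]. *)
pose A : 'M[R]_d := \matrix_(k, j) ((j == k)%:R - Q j k + (k == i0)%:R).
have AE (v : 'rV[R]_d) j : (v *m A) ord0 j = v ord0 j - mxop Q (v ord0) j + v ord0 i0.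
  rewrite mxE; under eq_bigr do rewrite mxE mulrDr mulrBr.
  rewrite big_split/= sumrB; congr (_ - _ + _).
  - rewrite (bigD1 j)//= eqxx mulr1 big1 ?addr0// => k kj.
    by rewrite eq_sym (negbTE kj) mulr0.
  - by apply: eq_bigr => k _; rewrite mulrC.
  - rewrite (bigD1 i0)//= eqxx mulr1 big1 ?addr0// => k kj.
    by rewrite (negbTE kj) mulr0.
have Aunit : A \in unitmx.
  rewrite -row_free_unit -kermx_eq0; apply/rowV0P => v /sub_kermxP vA.
  have vE j : v ord0 j - mxop Q (v ord0) j + v ord0 i0 = 0 by rewrite -AE vA mxE.
  have v0 : v ord0 i0 = 0.
    apply/eqP; rewrite eq_le; apply/andP; split.
      have [i hi] := ex_argmax i0 (v ord0).
      have : mxop Q (v ord0) i <= v ord0 i.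
        rewrite -[leRHS]mul1r -(Q1 i) mulr_suml; apply: ler_sum => k _.
        by rewrite ler_wpM2l// ltW.
      by have := vE i; lra.
    have [i hi] := ex_argmin i0 (v ord0).
    have : v ord0 i <= mxop Q (v ord0) i.
      rewrite -[leLHS]mul1r -(Q1 i) mulr_suml; apply: ler_sum => k _.
      by rewrite ler_wpM2l// ltW.
    by have := vE i; lra.
  have vc := @mxop_harmonic_cst Q (v ord0) Q0 Q1.
  apply/rowP => j; rewrite mxE vc// => k.
  by have := vE k; rewrite v0 addr0 => /eqP; rewrite subr_eq0 => /eqP.
pose x := \row_j f j *m invmx A.
exists (x ord0 i0), (x ord0) => j.
have : (x *m A) ord0 j = f j by rewrite mulmxKV// mxE.
by rewrite AE; lra.
Qed.

(** Doeblin's argument: every row gives [i0] at least the mass [Q l i0], and this common mass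
    cancels in a difference of two averages. *)
Lemma mxop_osc_contract Q : (forall j k, 0 < Q j k) -> (forall j, \sum_k Q j k = 1) ->
  exists rho : R, [/\ 0 <= rho, rho < 1 & forall x D, (forall i j, x i - x j <= D) ->
    forall i j, mxop Q x i - mxop Q x j <= rho * D].
Proof.
move=> Q0 Q1; have [l hl] := ex_argmin i0 (fun j => Q j i0).
have Q_le1 j k : Q j k <= 1.
  by rewrite -(Q1 j) (bigD1 k)//= lerDl; apply: sumr_ge0 => k' _; exact: ltW.
exists (1 - Q l i0); split => [||x D xD i j]; first by rewrite subr_ge0.
  by rewrite ltrBlDr ltrDl.
have [m hm] := ex_argmin i0 x.
pose y k := x k - x m.
have yE a : mxop Q x a - x m = \sum_k Q a k * y k.
  by rewrite /y; under eq_bigr do rewrite mulrBr; rewrite sumrB -mulr_suml Q1 mul1r.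
have y0 k : 0 <= y k by rewrite subr_ge0.
have yD k : y k <= D by exact: xD.
have h1 : mxop Q x i - x m <= (1 - Q i i0) * D + Q i i0 * y i0.
  rewrite yE -(Q1 i) (bigD1 i0)//= [in leRHS](bigD1 i0)//= addrAC subrr add0r addrC lerD2r.
  rewrite mulr_suml; apply: ler_sum => k _; rewrite ler_wpM2l// ltW//.
have h2 : Q j i0 * y i0 <= mxop Q x j - x m.
  rewrite yE (bigD1 i0)//= lerDl; apply: sumr_ge0 => k _; rewrite mulr_ge0// ltW//.
have h3 : Q l i0 * y i0 <= Q j i0 * y i0 by rewrite ler_wpM2r.
have h4 : (Q i i0 - Q l i0) * y i0 <= (Q i i0 - Q l i0) * D.
  by rewrite ler_wpM2l// subr_ge0.
lra.
Qed.

(** The Poisson equation telescopes: [Q^n f - m = Q^n x - Q^(n+1) x], pointwise an average of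
    differences of values of [Q^n x], and these contract. *)
Lemma iter_mxop_cvg Q f m x : (forall j k, 0 < Q j k) -> (forall j, \sum_k Q j k = 1) ->
  (forall j, f j = m + x j - mxop Q x j) ->
  exists rho D : R, [/\ 0 <= rho, rho < 1 & forall n j, `|iter n (mxop Q) f j - m| <= rho ^+ n * D].
Proof.
move=> Q0 Q1 fE; have [rho [r0 r1 hr]] := mxop_osc_contract Q0 Q1.
have [a ha] := ex_argmax i0 x; have [b hb] := ex_argmin i0 x.
exists rho, (x a - x b); split => // n j.
have osc : forall i j, iter n (mxop Q) x i - iter n (mxop Q) x j <= rho ^+ n * (x a - x b).
  elim: n => [|n ih] i k; first by rewrite expr0 mul1r lerB.
  by rewrite exprS -mulrA; exact: hr.
have E k : iter n (mxop Q) f k = m + iter n (mxop Q) x k - mxop Q (iter n (mxop Q) x) k.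
  elim: n k {osc} => [|n ih] k; first exact: fE.
  rewrite !iterS {1}/mxop; under eq_bigr do rewrite ih mulrBr mulrDr.
  by rewrite sumrB big_split/= -mulr_suml Q1 mul1r.
rewrite E; set z := iter n (mxop Q) x in osc *.
have -> : m + z j - mxop Q z j - m = z j - mxop Q z j by ring.
have -> : z j - mxop Q z j = \sum_k Q j k * (z j - z k).
  by under eq_bigr do rewrite mulrBr; rewrite sumrB -mulr_suml Q1 mul1r.
apply: le_trans (ler_norm_sum _ _ _) _.
rewrite -[leRHS]mul1r -(Q1 j) mulr_suml; apply: ler_sum => k _.
rewrite normrM gtr0_norm// ler_wpM2l ?(ltW (Q0 _ _))// ler_norml lerNl opprB.
by apply/andP; split; exact: osc.
Qed.

Lemma le_iter_mxop M u v n j : (forall j k, 0 <= M j k) -> (forall j, u j <= v j) ->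
  iter n (mxop M) u j <= iter n (mxop M) v j.
Proof.
move=> M0 uv; elim: n j => [|n ih] j; first exact: uv.
by rewrite !iterS; apply: ler_sum => k _; rewrite ler_wpM2l.
Qed.

(** The constant [1] lies between two multiples of [u], on which iteration is multiplication by
    [lam]. *)
Lemma iter_mxop_growth M lam u : (forall j k, 0 <= M j k) -> (forall j, 0 < u j) ->
  (forall j, mxop M u j = lam * u j) ->
  exists c C : R, [/\ 0 < c, 0 < C & forall n j,
    c * lam ^+ n <= iter n (mxop M) (fun=> 1) j <= C * lam ^+ n].
Proof.
move=> M0 u0 Mu.
have E a n j : iter n (mxop M) (fun k => a * u k) j = a * u j * lam ^+ n.
  elim: n j => [|n ih] j; first by rewrite mulr1.
  have h k : M j k * (a * u k * lam ^+ n) = a * lam ^+ n * (M j k * u k) by ring.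
  rewrite iterS /mxop; under eq_bigr do rewrite ih h.
  by rewrite -mulr_sumr -/(mxop M u j) Mu exprS; ring.
have [a ha] := ex_argmax i0 u; have [b hb] := ex_argmin i0 u.
have lam0 : 0 <= lam.
  rewrite leNgt; apply/negP => l0.
  have : 0 <= mxop M u i0 by apply: mxop_ge0 => // k; exact: ltW.
  by rewrite Mu leNgt nmulr_rlt0// u0.
exists (u b / u a), (u a / u b); split; rewrite ?divr_gt0// => n j.
have ln0 : 0 <= lam ^+ n by exact: exprn_ge0.
apply/andP; split.
  apply: (@le_trans _ _ (iter n (mxop M) (fun k => (u a)^-1 * u k) j)).
    by rewrite E ler_wpM2r// mulrC ler_wpM2l// invr_ge0 ltW.
  by apply: le_iter_mxop => // k; rewrite mulrC ler_pdivrMr// mul1r.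
apply: (@le_trans _ _ (iter n (mxop M) (fun k => (u b)^-1 * u k) j)).
  by apply: le_iter_mxop => // k; rewrite mulrC ler_pdivlMr// mul1r.
by rewrite E ler_wpM2r// mulrC ler_wpM2r// invr_ge0 ltW.
Qed.

End PositiveMatrices.

(** * Complex phases *)

Local Open Scope complex_scope.
Local Open Scope ring_scope.

Section ComplexModulus.
Context {R : realType}.
Implicit Types (x y : R) (z : R[i]).
Local Notation cre := (@complex.Re R).
Local Notation cim := (@complex.Im R).

(** A modulus with values in [R], so that estimates are made in the real field rather than in the
    partial order of [R[i]]. *)
Definition cmod z : R := Normc.normc z.
Definition cis x : R[i] := Complex (cos x) (sin x).

Lemma cmodM z1 z2 : cmod (z1 * z2) = cmod z1 * cmod z2.
Proof. exact: Normc.normcM. Qed.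

Lemma cmodD z1 z2 : cmod (z1 + z2) <= cmod z1 + cmod z2.
Proof. exact: (@le_normcD R). Qed.

Lemma cmodN z : cmod (- z) = cmod z.
Proof. exact: (@normcN R). Qed.

Lemma cmodBC z1 z2 : cmod (z1 - z2) = cmod (z2 - z1).
Proof. by rewrite -cmodN opprB. Qed.

Lemma cmod_ge0 z : 0 <= cmod z.
Proof. by case: z => a b; exact: sqrtr_ge0. Qed.

Lemma cmod0 : cmod 0 = 0. Proof. exact: Normc.normc0. Qed.

Lemma cmod_real x : cmod x%:C = `|x|.
Proof. by rewrite /cmod /= expr0n addr0 sqrtr_sqr. Qed.

Lemma cmod_sum (I : Type) (s : seq I) (P : pred I) (F : I -> R[i]) :
  cmod (\sum_(i <- s | P i) F i) <= \sum_(i <- s | P i) cmod (F i).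
Proof.
elim/big_rec2: _ => [|i x z _ ih]; first by rewrite cmod0.
by apply: le_trans (cmodD _ _) _; rewrite lerD2l.
Qed.

Lemma sqr_cmod z : cmod z ^+ 2 = cre z ^+ 2 + cim z ^+ 2.
Proof. by case: z => a b; rewrite /cmod /= sqr_sqrtr// addr_ge0 ?sqr_ge0. Qed.

Lemma cre_le_cmod z : `|cre z| <= cmod z.
Proof.
rewrite -[leRHS]ger0_norm ?cmod_ge0// -ler_sqr ?nnegrE ?normr_ge0//.
by rewrite !real_normK ?num_real// sqr_cmod lerDl sqr_ge0.
Qed.

Lemma cmod_cis x : cmod (cis x) = 1.
Proof. by rewrite /cmod /= cos2Dsin2 sqrtr1. Qed.

Lemma cisD x y : cis (x + y) = cis x * cis y.
Proof. by rewrite /cis cosD sinD; congr Complex; rewrite addrC. Qed.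

Lemma cis0 : cis 0 = 1.
Proof. by rewrite /cis cos0 sin0. Qed.

Lemma cmod_le_ReIm z : cmod z <= `|cre z| + `|cim z|.
Proof.
rewrite -ler_sqr ?nnegrE ?cmod_ge0 ?addr_ge0// sqr_cmod sqrrD !real_normK ?num_real//.
by rewrite lerD2r lerDl mulrn_wge0// mulr_ge0.
Qed.

End ComplexModulus.

(** * Cancellation in weighted sums of phases *)

Section WeightedSums.
Context {R : realType}.
Local Notation cre := (@complex.Re R).
Local Notation cim := (@complex.Im R).

Lemma cre_sum (I : finType) (F : I -> R[i]) : cre (\sum_i F i) = \sum_i cre (F i).
Proof. by apply: (big_morph cre) => // -[a b] [a' b']. Qed.

Lemma cim_sum (I : finType) (F : I -> R[i]) : cim (\sum_i F i) = \sum_i cim (F i).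
Proof. by apply: (big_morph cim) => // -[a b] [a' b']. Qed.

Lemma cre_realM (a x : R) : cre (a%:C * cis x) = a * cos x.
Proof. by rewrite /cis /= mul0r subr0. Qed.

Lemma cim_realM (a x : R) : cim (a%:C * cis x) = a * sin x.
Proof. by rewrite /cis /= mul0r addr0. Qed.

(** The squared modulus is exactly [W^2 - E], with [W] the total weight and [E] the double sum; then
    [W^2 - E <= (W - E / (2 W))^2]. *)
Lemma cmod_weighted_sum (I : finType) (w th : I -> R) :
  (forall i, 0 <= w i) -> 0 < \sum_i w i ->
  cmod (\sum_i (w i)%:C * cis (th i)) <= \sum_i w i -
    (\sum_i \sum_j w i * w j * (1 - cos (th i - th j))) / (2 * \sum_i w i).
Proof.
move=> w0; set W := \sum_i w i => W0; set E := \sum_i \sum_j _.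
have W2 : W ^+ 2 = \sum_i \sum_j w i * w j by rewrite expr2 big_distrlr.
have E_ge0 : 0 <= E.
  by apply: sumr_ge0 => i _; apply: sumr_ge0 => j _; rewrite !mulr_ge0// subr_ge0 cos_le1.
have E_le : E <= 2 * W ^+ 2.
  rewrite W2 mulr_sumr; apply: ler_sum => i _; rewrite mulr_sumr; apply: ler_sum => j _.
  by rewrite [leRHS]mulrC ler_wpM2l ?mulr_ge0//; have := cos_geN1 (th i - th j); lra.
have sq : cmod (\sum_i (w i)%:C * cis (th i)) ^+ 2 = W ^+ 2 - E.
  rewrite sqr_cmod cre_sum cim_sum.
  under eq_bigr do rewrite cre_realM.
  under [X in _ + X ^+ 2]eq_bigr do rewrite cim_realM.
  rewrite W2 !expr2 !big_distrlr/= -sumrB -big_split; apply: eq_bigr => i _ /=.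
  rewrite -sumrB -big_split; apply: eq_bigr => j _ /=.
  rewrite cosB; ring.
have W20 : 0 < 2 * W by rewrite mulr_gt0.
have WE : 0 <= W - E / (2 * W).
  by rewrite subr_ge0 ler_pdivrMr// mulrCA -expr2.
rewrite -ler_sqr ?nnegrE ?cmod_ge0// sq sqrrB.
have -> : W * (E / (2 * W)) *+ 2 = E by field; rewrite gt_eqF.
by rewrite lerDl sqr_ge0.
Qed.

Lemma cos_eq1 (x : R) : cos x = 1 -> exists m : int, x = m%:~R * (2 * pi).
Proof.
move=> cx; exists (Num.floor (x / (2 * pi))).
have p0 : 0 < 2 * pi :> R by rewrite mulr_gt0// pi_gt0.
set m := Num.floor _.
pose y := x - m%:~R * (2 * pi).
have y0 : 0 <= y by rewrite subr_ge0 -ler_pdivlMr// floor_le.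
have y1 : y < 2 * pi.
  rewrite ltrBlDl -[X in _ + X]mul1r -mulrDl -ltr_pdivrMr//.
  by have := floorD1_gt (x / (2 * pi)); rewrite intrD.
have cy : cos y = 1.
  have pE (n : nat) : (Posz n)%:~R * (2 * pi) = pi *+ 2 *+ n :> R.
    by rewrite -[RHS]mulr_natl -[pi *+ 2]mulr_natl.
  rewrite -cx /y; case: (m) => n.
    rewrite -[LHS](periodicn (@cosD2pi R) n); congr cos.
    by rewrite pE subrK.
  rewrite -[RHS](periodicn (@cosD2pi R) n.+1) NegzE; congr cos.
  by rewrite mulrNz mulNr pE opprK.
have h2 : y = (y / 2) *+ 2 by rewrite -mulr_natr divfK.
have s2 : sin (y / 2) = 0.
  move: cy; rewrite {1}h2 cos_mulr2n cos2sin2 => h.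
  by apply/eqP; rewrite -sqrf_eq0; apply/eqP; lra.
have [y00|] := boolP (0 < y / 2).
  have y2 : 0 < y / 2 < pi by rewrite y00 ltr_pdivrMr// mulrC.
  by have := sin_gt0_pi y2; rewrite s2 ltxx.
rewrite -leNgt => yle; have : y = 0 by lra.
by move/eqP; rewrite subr_eq0 => /eqP.
Qed.

(** Near [0] a single nonzero [D i] gives the quadratic growth; away from [0] the sum has a positive
    minimum by compactness. *)
Lemma sum_cos_quadratic_bound (J : finType) (D : J -> R) :
  (forall s, 0 < s -> \sum_i (1 - cos (s * D i)) != 0) ->
  forall A, 0 < A -> exists2 c, 0 < c &
    forall s, 0 <= s <= A -> c * s ^+ 2 <= \sum_i (1 - cos (s * D i)).
Proof.
move=> nz A A0; pose f s := \sum_i (1 - cos (s * D i)).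
have t0 s i : 0 <= 1 - cos (s * D i) by rewrite subr_ge0 cos_le1.
have f0 s : 0 <= f s by exact: sumr_ge0.
have [i Di] : exists i, D i != 0.
  apply/existsP; rewrite -negb_forall; apply/negP => /forallP h.
  have /negP := nz 1 ltr01; apply; apply/eqP/big1 => i _.
  by have /eqP -> := h i; rewrite mulr0 cos0 subrr.
(* For [s <= e] one has [s |D i| <= 1], the range of [one_sub_cos_ge]. *)
pose e := Num.min A `|D i|^-1.
have e0 : 0 < e by rewrite lt_min A0 invr_gt0 normr_gt0.
have eA : e <= A by rewrite ge_min lexx.
have cf : continuous f.
  apply: continuous_big => [|k _]; first exact: add_continuous.
  move=> s; apply: continuousB; first exact: cst_continuous.
  exact: continuous_cosM.
have [s0 s0e fmin] := EVT_min eA (continuous_subspaceT cf).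
have s00 : 0 < s0 by move: s0e; rewrite in_itv/= => /andP[+ _]; exact: lt_le_trans.
have fs0 : 0 < f s0 by rewrite lt_def f0 nz.
exists (Num.min (f s0 / A ^+ 2) (D i ^+ 2 / 4)).
  rewrite lt_min divr_gt0 ?exprn_gt0//= divr_gt0//.
  by rewrite exprn_even_gt0.
move=> s /andP[sge sle].
have [se|se] := leP s e.
  apply: (@le_trans _ _ (D i ^+ 2 / 4 * s ^+ 2)).
    by rewrite ler_wpM2r ?sqr_ge0// ge_min lexx orbT.
  have -> : D i ^+ 2 / 4 * s ^+ 2 = (s * D i) ^+ 2 / 4 by ring.
  apply: (@le_trans _ _ (1 - cos (s * D i))).
    apply: one_sub_cos_ge; rewrite normrM (ger0_norm sge) -ler_pdivlMr ?normr_gt0// mul1r.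
    by rewrite (le_trans se)// ge_min lexx orbT.
  by rewrite (bigD1 i)//= lerDl; exact: sumr_ge0.
apply: (@le_trans _ _ (f s0 / A ^+ 2 * s ^+ 2)).
  by rewrite ler_wpM2r ?sqr_ge0// ge_min lexx.
apply: (@le_trans _ _ (f s0)); last by apply: fmin; rewrite in_itv/= sle (ltW se).
rewrite -mulrA ler_piMr// mulrC ler_pdivrMr ?exprn_gt0// mul1r.
by rewrite lerXn2r ?nnegrE// ltW.
Qed.

End WeightedSums.

(** * Twisted stochastic matrices *)

Section Twist.
Context {R : realType} (d : nat) (i0 : 'I_d) (Q : 'I_d -> 'I_d -> R).
Hypothesis Q0 : forall j k, 0 < Q j k.
Hypothesis Q1 : forall j, \sum_k Q j k = 1.
Implicit Types (z : 'I_d -> 'I_d -> R) (s B : R) (g : 'I_d -> R[i]).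

Definition twist z s : 'I_d -> 'I_d -> R[i] := fun j k => (Q j k)%:C * cis (s * z j k).

Lemma cmod_twist z s j k : cmod (twist z s j k) = Q j k.
Proof. by rewrite cmodM cmod_cis mulr1 cmod_real gtr0_norm. Qed.

Lemma cmod_mxop_twist z s g B : (forall k, cmod (g k) <= B) ->
  forall j, cmod (mxop (twist z s) g j) <= B.
Proof.
move=> gB j; apply: le_trans (cmod_sum _ _ _) _.
rewrite -[leRHS]mul1r -(Q1 j) mulr_suml; apply: ler_sum => k _.
by rewrite cmodM cmod_twist ler_wpM2l// ltW.
Qed.

Lemma mxopB (W : 'I_d -> 'I_d -> R[i]) g1 g2 j :
  mxop W g1 j - mxop W g2 j = mxop W (fun k => g1 k - g2 k) j.
Proof. by rewrite /mxop -sumrB; apply: eq_bigr => k _; rewrite mulrBr. Qed.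

Lemma cmod_iter_twistB z s g1 g2 B : (forall k, cmod (g1 k - g2 k) <= B) ->
  forall n j, cmod (iter n (mxop (twist z s)) g1 j - iter n (mxop (twist z s)) g2 j) <= B.
Proof.
move=> gB; elim=> [|n ih] j; first exact: gB.
by rewrite !iterS mxopB; exact: cmod_mxop_twist.
Qed.

Lemma cmod_iter_twist z s g B : (forall k, cmod (g k) <= B) ->
  forall n j, cmod (iter n (mxop (twist z s)) g j) <= B.
Proof. by move=> gB; elim=> [|n ih] j; [exact: gB|rewrite iterS; exact: cmod_mxop_twist]. Qed.

(* [cycle_defect z j s = 0] forces [s * z] to be a coboundary plus a constant modulo [2 pi]:
   it compares the paths [j -> l -> k] with [j -> j -> k]. *)
Definition cycle_defect z j s : R :=
  \sum_(p : 'I_d * 'I_d) (1 - cos (s * (z j p.1 + z p.1 p.2 - (z j j + z j p.2)))).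

(** One step need not contract, since the phases of [g] can undo those of a row. After two steps the
    coefficient of [g k] is a sum over intermediate states [l], whose cancellation does not involve
    [g]. Of the pairs compared by [cmod_weighted_sum] only those with [j] are kept, each with weight
    at least [q^4]. *)
Lemma twist2_contract z : exists2 w, 0 < w & forall s g B j, (forall k, cmod (g k) <= B) ->
  cmod (mxop (twist z s) (mxop (twist z s) g) j) <= (1 - w * cycle_defect z j s) * B.
Proof.
have [p hp] := ex_argmin (i0, i0) (fun p : 'I_d * 'I_d => Q p.1 p.2).
set q := Q p.1 p.2; have q0 : 0 < q by exact: Q0.
have hq j k : q <= Q j k by exact: (hp (j, k)).
exists (q ^+ 4 / 2) => [|s g B j gB]; first by rewrite divr_gt0// exprn_gt0.
have B0 : 0 <= B by rewrite (le_trans (cmod_ge0 _) (gB i0)).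
pose th k l := s * (z j l + z l k).
pose c k := \sum_l (Q j l * Q l k)%:C * cis (th k l).
have -> : mxop (twist z s) (mxop (twist z s) g) j = \sum_k c k * g k.
  rewrite /mxop; under eq_bigr do rewrite mulr_sumr.
  rewrite exchange_big; apply: eq_bigr => k _; rewrite /c mulr_suml; apply: eq_bigr => l _.
  by rewrite mulrA; congr (_ * _); rewrite /twist /th mulrDr cisD rmorphM/=; ring.
apply: le_trans (cmod_sum _ _ _) _.
pose W k := \sum_l Q j l * Q l k.
have W0 k : 0 < W k.
  by rewrite /W (bigD1 i0)//= ltr_pwDl ?mulr_gt0// sumr_ge0// => l _; rewrite mulr_ge0// ltW.
have W1 : \sum_k W k = 1.
  rewrite /W exchange_big/=; under eq_bigr do rewrite -mulr_sumr Q1 mulr1.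
  exact: Q1.
have W_le1 k : W k <= 1 by rewrite -W1 (bigD1 k)//= lerDl sumr_ge0// => k' _; rewrite ltW.
have ck k : cmod (c k) <= W k - q ^+ 4 / 2 * \sum_l (1 - cos (th k l - th k j)).
  have w0 l : 0 <= Q j l * Q l k by rewrite mulr_ge0// ltW.
  apply: le_trans (cmod_weighted_sum (th k) w0 (W0 k)) _.
  rewrite -/(W k) lerD2l lerN2.
  set S := \sum_l (1 - cos _); set E := (X in _ <= X / _).
  have SE : q ^+ 4 * S <= E.
    rewrite /S /E mulr_sumr; apply: ler_sum => l _.
    have c0 i : 0 <= 1 - cos (th k l - th k i) by rewrite subr_ge0 cos_le1.
    rewrite (bigD1 j)//= ler_wpDr//.
      by apply: sumr_ge0 => i _; rewrite !mulr_ge0// ltW.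
    rewrite ler_wpM2r//.
    have -> : q ^+ 4 = (q * q) * (q * q) by ring.
    by rewrite ler_pM ?mulr_ge0 ?(ltW q0)// ler_pM ?(ltW q0).
  have S0 : 0 <= S by apply: sumr_ge0 => l _; rewrite subr_ge0 cos_le1.
  have q4 : 0 <= q ^+ 4 * S by rewrite mulr_ge0// exprn_ge0// ltW.
  rewrite ler_pdivlMr ?mulr_gt0//.
  have -> : q ^+ 4 / 2 * S * (2 * W k) = q ^+ 4 * S * W k by field.
  by rewrite (le_trans _ SE)// ler_piMr.
apply: (@le_trans _ _ (\sum_k (W k - q ^+ 4 / 2 * \sum_l (1 - cos (th k l - th k j))) * B)).
  by apply: ler_sum => k _; rewrite cmodM ler_pM ?cmod_ge0.
rewrite -mulr_suml sumrB W1 -mulr_sumr; rewrite le_eqVlt; apply/orP; left; apply/eqP.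
congr ((_ - _ * _) * _); rewrite exchange_big pair_big; apply: eq_bigr => -[l k] _ /=.
by rewrite /th mulrBr.
Qed.

Lemma twist_decay z : (forall s, 0 < s -> forall j, cycle_defect z j s != 0) ->
  forall A, 0 < A -> exists C c, [/\ 0 <= C, 0 < c & forall s, 0 <= s <= A ->
    forall g B n j, (forall k, cmod (g k) <= B) ->
    cmod (iter n (mxop (twist z s)) g j) <= C * B * expR (- c * s ^+ 2 * n%:R)].
Proof.
move=> nz A A0; have [w w0 hw] := twist2_contract z.
have hj j : exists c : R, 0 < c /\ forall s, 0 <= s <= A -> c * s ^+ 2 <= cycle_defect z j s.
  have [|c c0 hc] := @sum_cos_quadratic_bound _ _ (fun p : 'I_d * 'I_d =>
    z j p.1 + z p.1 p.2 - (z j j + z j p.2)) _ _ A0; last by exists c.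
  by move=> s s0; exact: nz.
have [f hf] := fin_all_exists hj.
have [jm hjm] := ex_argmin i0 f; have [c0 _] := hf jm.
(* Halved because the contraction [1 - 2 c s^2 <= expR (- 2 c s^2)] is paid for by two steps. *)
pose c := w * f jm / 2.
have cg0 : 0 < c by rewrite divr_gt0// mulr_gt0.
exists (expR (c * A ^+ 2)), c; split; [exact: expR_ge0|exact: cg0|].
move=> s sA g B n j gB; have /andP[s0 sA'] := sA.
have B0 : 0 <= B by rewrite (le_trans (cmod_ge0 _) (gB i0)).
have step B' g' : (forall k, cmod (g' k) <= B') ->
    forall i, cmod (mxop (twist z s) (mxop (twist z s) g') i) <= expR (- (2 * c * s ^+ 2)) * B'.
  move=> gB' i; have B'0 : 0 <= B' by rewrite (le_trans (cmod_ge0 _) (gB' i0)).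
  apply: le_trans (hw _ _ _ _ gB') _; rewrite ler_wpM2r//.
  apply: le_trans (expR_ge1Dx _); rewrite lerD2l lerN2.
  have -> : 2 * c * s ^+ 2 = w * (f jm * s ^+ 2) by rewrite /c; field.
  rewrite ler_wpM2l ?(ltW w0)//; have [_ h] := hf i; apply: le_trans (h _ sA).
  by rewrite ler_wpM2r ?sqr_ge0.
(* Two consecutive ranks are carried because the contraction advances by two; the factor
   [expR (c s^2)] pays for an odd step. *)
have claim n' : (forall i, cmod (iter n' (mxop (twist z s)) g i) <=
      B * expR (c * s ^+ 2 - c * s ^+ 2 * n'%:R)) /\
    (forall i, cmod (iter n'.+1 (mxop (twist z s)) g i) <=
      B * expR (c * s ^+ 2 - c * s ^+ 2 * n'.+1%:R)).
  elim: n' => [|n' [ih1 ih2]].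
    rewrite mulr0 subr0 mulr1 subrr expR0 mulr1; split => i.
      apply: le_trans (gB i) _; rewrite ler_peMr// -expR0 ler_expR.
      by rewrite mulr_ge0 ?sqr_ge0// ltW.
    exact: cmod_mxop_twist.
  split => // i; rewrite !iterS; apply: le_trans (step _ _ ih1 i) _.
  rewrite mulrCA -expRD ler_wpM2l// ler_expR -!natr1; lra.
have [h _] := claim n.
apply: le_trans (h j) _; rewrite [leRHS]mulrAC -expRD [leRHS]mulrC ler_wpM2l// ler_expR.
have : c * s ^+ 2 <= c * A ^+ 2 by rewrite ler_wpM2l ?(ltW cg0)// lerXn2r ?nnegrE// ltW.
by rewrite !mulNr; lra.
Qed.

End Twist.

Section CisBounds.
Context {R : realType}.
Implicit Types x : R.

Lemma sin_le_norm x : `|sin x| <= `|x|.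
Proof.
have := cos_lipschitz (x - pi / 2) (- (pi / 2)).
by rewrite cosBpihalf cosN cos_pihalf subr0 opprK subrK.
Qed.

Lemma cmod_cis_sub1 x : cmod (cis x - 1) <= 2 * `|x|.
Proof.
apply: le_trans (cmod_le_ReIm _) _; rewrite /cis /= oppr0 addr0.
have := cos_lipschitz x 0; rewrite cos0 subr0; have := sin_le_norm x; lra.
Qed.

Lemma cis_taylor x : cmod (cis x - Complex (1 - x ^+ 2 / 2) x) <= 2 * `|x| ^+ 3.
Proof.
apply: le_trans (cmod_le_ReIm _) _; rewrite /cis /=.
have := cos_taylor x; have := sin_taylor x; lra.
Qed.

Lemma expR_opp_taylor x : 0 <= x -> x <= 1 / 2 -> 0 <= expR (- x) - (1 - x) <= 2 * x ^+ 2.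
Proof.
move=> x0 x1; have h1 := expR_ge1Dx (- x).
have := @expR_le_quad _ (- x); rewrite normrN ger0_norm// sqrrN => /(_ x1) h2.
by apply/andP; split; lra.
Qed.

Lemma fin_bounded (I : finType) (f : I -> R) : exists2 B : R, 0 <= B & forall i, `|f i| <= B.
Proof.
exists (\sum_i `|f i|) => [|i]; first exact: sumr_ge0.
by rewrite (bigD1 i)//= lerDl; exact: sumr_ge0.
Qed.

End CisBounds.

(** * Gaussian limit of the twisted iterates *)

Section TwistCLT.
Context {R : realType} (d : nat) (i0 : 'I_d) (Q : 'I_d -> 'I_d -> R).
Hypothesis Q0 : forall j k, 0 < Q j k.
Hypothesis Q1 : forall j, \sum_k Q j k = 1.
Local Notation cre := (@complex.Re R).
Local Notation cim := (@complex.Im R).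

(** Adding a coboundary to [z] conjugates the twisted matrix by the diagonal phases [cis (s * H)];
    this is what allows every row to be centred. *)
Lemma iter_twist_coboundary (z : 'I_d -> 'I_d -> R) (H : 'I_d -> R) s g n j :
  iter n (mxop (twist Q z s)) g j =
  cis (s * H j) * iter n (mxop (twist Q (fun j k => z j k + H k - H j) s))
     (fun k => cis (- (s * H k)) * g k) j.
Proof.
elim: n j => [|n ih] j; first by rewrite mulrA -cisD subrr cis0 mul1r.
rewrite !iterS /mxop mulr_sumr; apply: eq_bigr => k _.
rewrite ih mulrA [in RHS]mulrA; congr (_ * _).
rewrite /twist -mulrA -cisD mulrCA -cisD; congr (_ * cis _); ring.
Qed.

Lemma cmod_mxop_real (E : 'I_d -> R[i]) (g : 'I_d -> R) j a b : (forall k, cmod (E k) <= a) ->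
  (forall k, `|g k| <= b) -> cmod (\sum_k (Q j k)%:C * E k * (g k)%:C) <= a * b.
Proof.
move=> Ea gb; apply: le_trans (cmod_sum _ _ _) _.
rewrite -[leRHS]mul1r -(Q1 j) mulr_suml; apply: ler_sum => k _.
rewrite 2!cmodM !cmod_real gtr0_norm// -mulrA ler_wpM2l ?(ltW (Q0 _ _))//.
by rewrite ler_pM ?cmod_ge0.
Qed.

Lemma norm_wavg_le (f : 'I_d -> R) j b : (forall k, `|f k| <= b) -> `|\sum_k Q j k * f k| <= b.
Proof.
move=> fb; apply: le_trans (ler_norm_sum _ _ _) _.
rewrite -[leRHS]mul1r -(Q1 j) mulr_suml; apply: ler_sum => k _.
by rewrite normrM gtr0_norm// ler_wpM2l// ltW.
Qed.

Section Centered.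
Variables (y : 'I_d -> 'I_d -> R) (sigma : R) (w : 'I_d -> R).
Hypothesis y_centered : forall j, \sum_k Q j k * y j k = 0.
Hypothesis sigma0 : 0 <= sigma.
Hypothesis y_var : forall j, \sum_k Q j k * y j k ^+ 2 = sigma + w j - mxop Q w j.

(* Second order perturbation: [1 - s^2 w / 2] is an eigenvector up to [O(s^3)]. *)
Lemma twist_approx_eigenvector : exists C s1 : R, [/\ 0 <= C, 0 < s1 & forall s : R, 0 <= s <= s1 ->
  forall j, cmod (mxop (twist Q y s) (fun k => (1 - s ^+ 2 / 2 * w k)%:C) j -
    (expR (- (sigma * s ^+ 2 / 2)) * (1 - s ^+ 2 / 2 * w j))%:C) <= C * s ^+ 3].
Proof.
have [W W0 hW] := fin_bounded w.
have [Y Y0 hY'] := fin_bounded (fun p : 'I_d * 'I_d => y p.1 p.2).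
have hY j k : `|y j k| <= Y := hY' (j, k).
(* The bound [s1] ensures [s <= 1] and [sigma s^2 <= 1], so that fourth powers are absorbed in [s^3]
   and [expR_opp_taylor] applies. *)
exists (2 * Y ^+ 3 * (1 + W) + Y * W / 2 + Y ^+ 2 * W / 4 + sigma * W / 4 +
   sigma ^+ 2 / 2 * (1 + W)), (1 + sigma)^-1.
have sg0 : 0 <= sigma := sigma0.
have sg1 : 0 < 1 + sigma by rewrite ltr_pwDl.
split; last first.
- move=> s /andP[s0 ss1] j.
  have s1 : s <= 1 by rewrite (le_trans ss1)// invf_le1// lerDl.
  have ssg : s * sigma <= 1.
    apply: (@le_trans _ _ ((1 + sigma)^-1 * sigma)); first by rewrite ler_wpM2r.
    by rewrite mulrC ler_pdivrMr// mul1r lerDr.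
  have s2 : s ^+ 2 <= 1 by rewrite exprn_ile1.
  have s20 : 0 <= s ^+ 2 by exact: sqr_ge0.
  have ss2 : sigma * s ^+ 2 <= 1.
    by rewrite expr2 mulrA (mulrC sigma) -[leRHS]mulr1 ler_pM ?mulr_ge0.
  have hv k : `|1 - s ^+ 2 / 2 * w k| <= 1 + W.
    have := hW k; rewrite !ler_norml => /andP[h1 h2]; apply/andP; split; nra.
  set q := expR _; set v := fun k => 1 - s ^+ 2 / 2 * w k.
  have [r1 r2] : 0 <= q - (1 - sigma * s ^+ 2 / 2) /\
      q - (1 - sigma * s ^+ 2 / 2) <= 2 * (sigma * s ^+ 2 / 2) ^+ 2.
    apply/andP/expR_opp_taylor; first by rewrite divr_ge0// mulr_ge0.
    by lra.
  pose e k := cis (s * y j k) - Complex (1 - (s * y j k) ^+ 2 / 2) (s * y j k).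
  have he k : cmod (e k) <= 2 * Y ^+ 3 * s ^+ 3.
    apply: le_trans (cis_taylor _) _; rewrite normrM (ger0_norm s0) exprMn -mulrA mulrCA.
    rewrite mulrC -mulrA ler_wpM2l// ler_wpM2r ?exprn_ge0// lerXn2r ?nnegrE//.
  pose m := \sum_k (Q j k)%:C * Complex (1 - (s * y j k) ^+ 2 / 2) (s * y j k) * (v k)%:C.
  have -> : mxop (twist Q y s) (fun k => (v k)%:C) j = m + \sum_k (Q j k)%:C * e k * (v k)%:C.
    rewrite /m -big_split; apply: eq_bigr => k _ /=.
    by rewrite -mulrDl -mulrDr /e addrC subrK.
  rewrite addrAC; apply: le_trans (cmodD _ _) _.
  have h1 := cmod_mxop_real j he hv.
  (* Centring kills the term of order [s], leaving order [s^3]. *)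
  have imm : cim m = - (s ^+ 3 / 2) * \sum_k Q j k * (y j k * w k).
    rewrite /m cim_sum; transitivity (s * \sum_k Q j k * y j k +
       - (s ^+ 3 / 2) * \sum_k Q j k * (y j k * w k)); last first.
      by rewrite y_centered mulr0 add0r.
    rewrite !mulr_sumr -big_split; apply: eq_bigr => k _ /=; rewrite /v; ring.
  (* By [y_var] the terms of order [s^2] add up to [sigma + w j]: the corrector [w] makes the
     variance effectively the same in every row. *)
  have rem : cre m = 1 - s ^+ 2 / 2 * (sigma + w j) +
      s ^+ 4 / 4 * \sum_k Q j k * (y j k ^+ 2 * w k).
    rewrite /m cre_sum; transitivity (\sum_k Q j k - s ^+ 2 / 2 * \sum_k Q j k * y j k ^+ 2
      - s ^+ 2 / 2 * mxop Q w j + s ^+ 4 / 4 * \sum_k Q j k * (y j k ^+ 2 * w k)).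
      rewrite /mxop !mulr_sumr -!sumrB -big_split; apply: eq_bigr => k _ /=; rewrite /v; by field.
    by rewrite Q1 y_var; ring.
  have b1 : `|\sum_k Q j k * (y j k * w k)| <= Y * W.
    by apply: norm_wavg_le => k; rewrite normrM ler_pM.
  have b2 : `|\sum_k Q j k * (y j k ^+ 2 * w k)| <= Y ^+ 2 * W.
    by apply: norm_wavg_le => k; rewrite normrM normrX ler_pM// lerXn2r ?nnegrE.
  have h2 : cmod (m - (q * v j)%:C) <= (Y * W / 2 + Y ^+ 2 * W / 4 + sigma * W / 4 +
      sigma ^+ 2 / 2 * (1 + W)) * s ^+ 3.
    apply: le_trans (cmod_le_ReIm _) _.
    have -> : cre (m - (q * v j)%:C) = cre m - q * v j by case: (m).
    have -> : cim (m - (q * v j)%:C) = cim m by case: (m) => ? ? /=; rewrite subr0.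
    rewrite imm rem.
    set b := \sum_k Q j k * (y j k ^+ 2 * w k) in b2 *.
    set b' := \sum_k Q j k * (y j k * w k) in b1 *.
    have s30 : 0 <= s ^+ 3 by exact: exprn_ge0.
    have s43 : s ^+ 4 <= s ^+ 3 by rewrite exprSr ler_piMr.
    have s40 : 0 <= s ^+ 4 by exact: exprn_ge0.
    have -> : 1 - s ^+ 2 / 2 * (sigma + w j) + s ^+ 4 / 4 * b - q * v j =
       s ^+ 4 * (b / 4 - sigma * w j / 4) - (q - (1 - sigma * s ^+ 2 / 2)) * v j.
      rewrite /v; by field.
    have g1 : `|s ^+ 4 * (b / 4 - sigma * w j / 4)| <= s ^+ 3 * (Y ^+ 2 * W / 4 + sigma * W / 4).
      rewrite normrM ger0_norm// ler_pM// (le_trans (ler_normB _ _))// lerD//.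
        by rewrite normrM [`|4^-1|]ger0_norm// ler_wpM2r.
      rewrite normrM [`|4^-1|]ger0_norm// ler_wpM2r// normrM ger0_norm// ler_wpM2l//.
    have g2 : `|(q - (1 - sigma * s ^+ 2 / 2)) * v j| <= s ^+ 3 * (sigma ^+ 2 / 2 * (1 + W)).
      rewrite normrM ger0_norm// [leRHS]mulrA ler_pM//.
      apply: (le_trans r2).
      have -> : 2 * (sigma * s ^+ 2 / 2) ^+ 2 = s ^+ 4 * (sigma ^+ 2 / 2) by field.
      by rewrite ler_wpM2r// divr_ge0// sqr_ge0.
      exact: hv.
    have g3 : `|- (s ^+ 3 / 2) * b'| <= s ^+ 3 * (Y * W / 2).
      have s32 : 0 <= s ^+ 3 / 2 by rewrite divr_ge0.
      rewrite mulNr normrN normrM (ger0_norm s32).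
      have -> : s ^+ 3 * (Y * W / 2) = s ^+ 3 / 2 * (Y * W) by field.
      by rewrite ler_wpM2l.
    have g4 := ler_normB (s ^+ 4 * (b / 4 - sigma * w j / 4))
      ((q - (1 - sigma * s ^+ 2 / 2)) * v j).
    apply: le_trans (lerD (le_trans g4 (lerD g1 g2)) g3) _.
    by rewrite le_eqVlt; apply/orP; left; apply/eqP; ring.
  apply: le_trans (lerD h2 h1) _.
  by rewrite le_eqVlt; apply/orP; left; apply/eqP; ring.
- by rewrite invr_gt0.
- by rewrite !addr_ge0 ?mulr_ge0 ?divr_ge0 ?exprn_ge0 ?addr_ge0 ?mulr_ge0 ?exprn_ge0.
Qed.

End Centered.
End TwistCLT.

Section TwistLimit.
Context {R : realType} (d : nat) (i0 : 'I_d) (Q : 'I_d -> 'I_d -> R).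
Hypothesis Q0 : forall j k, 0 < Q j k.
Hypothesis Q1 : forall j, \sum_k Q j k = 1.

Lemma mxopZ (K : comNzRingType) (I : finType) (W : I -> I -> K) c g j :
  mxop W (fun k => c * g k) j = c * mxop W g j.
Proof. by rewrite /mxop mulr_sumr; apply: eq_bigr => k _; rewrite mulrCA. Qed.

Lemma eq_mxop (K : nzSemiRingType) (I : finType) (W : I -> I -> K) g1 g2 j :
  g1 =1 g2 -> mxop W g1 j = mxop W g2 j.
Proof. by move=> g12; apply: eq_bigr => k _; rewrite g12. Qed.

Lemma iter_mxop_linear (W : 'I_d -> 'I_d -> R[i]) (c : R[i]) f g n j :
  iter n (mxop W) (fun k => f k + c * g k) j = iter n (mxop W) f j + c * iter n (mxop W) g j.
Proof.
elim: n j => [//|n ih] j; rewrite !iterS -mxopZ /mxop -big_split/=.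
by apply: eq_bigr => k _; rewrite ih mulrDr.
Qed.

(** Each step perturbs [Q] by [O(s)]; over a fixed number of steps this transfers the mixing of [Q]
    to the twisted matrix. *)
Lemma iter_twist_real (y : 'I_d -> 'I_d -> R) s f Y G n j :
  (forall j k, `|y j k| <= Y) -> (forall k, `|f k| <= G) -> 0 <= s ->
  cmod (iter n (mxop (twist Q y s)) (fun k => (f k)%:C) j - (iter n (mxop Q) f j)%:C)
    <= n%:R * (2 * (s * Y) * G).
Proof.
move=> yY fG s0.
have fnG m k : `|iter m (mxop Q) f k| <= G.
  by elim: m k => [|m ih] k; [exact: fG|rewrite iterS; exact: norm_wavg_le].
elim: n j => [|n ih] j; first by rewrite subrr cmod0 mul0r.
rewrite !iterS; set a := iter n _ _ in ih *; set b := iter n _ _ in ih *.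
have -> : mxop (twist Q y s) a j - (mxop Q b j)%:C =
    mxop (twist Q y s) (fun k => a k - (b k)%:C) j +
    \sum_k (Q j k)%:C * (cis (s * y j k) - 1) * (b k)%:C.
  rewrite -mxopB -addrA; congr (_ + _).
  rewrite /mxop rmorph_sum/= -!sumrN -big_split; apply: eq_bigr => k _ /=.
  rewrite rmorphM /= /twist; ring.
apply: le_trans (cmodD _ _) _; rewrite -natr1 mulrDl mul1r; apply: lerD.
  exact: cmod_mxop_twist.
apply: cmod_mxop_real => // [k|k]; last exact: fnG.
apply: le_trans (cmod_cis_sub1 _) _; rewrite ler_wpM2l// normrM ger0_norm//.
by rewrite ler_wpM2l.
Qed.

Section Eigen.
Variables (y : 'I_d -> 'I_d -> R) (sigma : R) (w : 'I_d -> R) (C s1 W : R).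

Hypothesis sigma0 : 0 <= sigma.
Hypothesis w_bounded : forall k, `|w k| <= W.
Hypothesis approx : forall s : R, 0 <= s <= s1 ->
  forall j, cmod (mxop (twist Q y s) (fun k => (1 - s ^+ 2 / 2 * w k)%:C) j -
    (expR (- (sigma * s ^+ 2 / 2)) * (1 - s ^+ 2 / 2 * w j))%:C) <= C * s ^+ 3.

(** Every step adds an error [C s^3], so for [s = u / sqrt n] the [n] errors total [O(s)]. Passing
    from [1] to the approximate eigenvector, and back, costs [s^2 W / 2] each time. *)
Lemma iter_twist_one s n j : 0 <= s <= s1 ->
  cmod (iter n (mxop (twist Q y s)) (fun=> 1) j - (expR (- (sigma * s ^+ 2 / 2)) ^+ n)%:C) <=
  n%:R * (C * s ^+ 3) + s ^+ 2 * W.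
Proof.
move=> ss; have hs := approx ss; set q := expR _ in hs *.
have /andP[s0 _] := ss.
have q0 : 0 <= q by exact: expR_ge0.
have q1 : q <= 1 by rewrite -expR0 ler_expR oppr_le0 divr_ge0// mulr_ge0 ?sqr_ge0.
have qn1 m : q ^+ m <= 1 by exact: exprn_ile1.
pose v k : R := 1 - s ^+ 2 / 2 * w k.
have h1 m i : cmod (iter m (mxop (twist Q y s)) (fun k => (v k)%:C) i - (q ^+ m * v i)%:C) <=
    m%:R * (C * s ^+ 3).
  elim: m i => [|m ih] i; first by rewrite mul1r subrr cmod0 mul0r.
  rewrite iterS; set a := iter m _ _ in ih *.
  have -> : mxop (twist Q y s) a i - (q ^+ m.+1 * v i)%:C =
      mxop (twist Q y s) (fun k => a k - (q ^+ m * v k)%:C) i +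
      (q ^+ m)%:C * (mxop (twist Q y s) (fun k => (v k)%:C) i - (q * v i)%:C).
    rewrite (mulrBr (q ^+ m)%:C) -mxopZ -mxopB.
    rewrite (@eq_mxop _ _ _ (fun k => (q ^+ m)%:C * (v k)%:C) (fun k => (q ^+ m * v k)%:C)).
      by rewrite subrKA -rmorphM/= exprSr mulrA.
    by move=> k; rewrite rmorphM.
  apply: le_trans (cmodD _ _) _; rewrite -natr1 mulrDl mul1r; apply: lerD.
    exact: cmod_mxop_twist.
  rewrite cmodM cmod_real ger0_norm ?exprn_ge0// -[leRHS]mul1r.
  by rewrite ler_pM ?exprn_ge0 ?cmod_ge0//; exact: hs.
have vb k : `|1 - v k| <= s ^+ 2 / 2 * W.
  rewrite /v opprB addrCA subrr addr0 normrM ger0_norm ?divr_ge0 ?sqr_ge0//.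
  by rewrite ler_wpM2l ?divr_ge0 ?sqr_ge0.
have h2 : cmod (iter n (mxop (twist Q y s)) (fun=> 1) j -
    iter n (mxop (twist Q y s)) (fun k => (v k)%:C) j) <= s ^+ 2 / 2 * W.
  apply: cmod_iter_twistB => // k.
  have -> : 1 - (v k)%:C = (1 - v k)%:C :> R[i] by rewrite (rmorphB (real_complex R) 1 (v k)) rmorph1.
  by rewrite cmod_real.
have h3 : cmod ((q ^+ n * v j)%:C - (q ^+ n)%:C) <= s ^+ 2 / 2 * W.
  rewrite -rmorphB cmod_real -[X in _ - X]mulr1 -mulrBr normrM ger0_norm ?exprn_ge0// distrC.
  by rewrite -[leRHS]mul1r ler_pM ?exprn_ge0.
have -> : s ^+ 2 * W = s ^+ 2 / 2 * W + s ^+ 2 / 2 * W by field.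
set a := iter _ _ _ _ in h2 *; set b := iter _ _ _ _ in h2 h1 *.
have -> : a - (q ^+ n)%:C = (a - b) + (b - (q ^+ n * v j)%:C) +
  ((q ^+ n * v j)%:C - (q ^+ n)%:C) by ring.
apply: (le_trans (cmodD _ _)); apply: (le_trans (lerD (cmodD _ _) h3)).
by have := h1 n j; rewrite -/b; move: h2; lra.
Qed.

End Eigen.

(** [g] is split into its stationary mean [m], which follows the approximate eigenvector, and a
    mean-zero part, killed by mixing; gauging away [H] costs [O(s)]. *)
Lemma twist_clt (z : 'I_d -> 'I_d -> R) (H : 'I_d -> R) :
  (forall j, \sum_k Q j k * (z j k + H k - H j) = 0) ->
  exists2 sigma : R, 0 <= sigma & forall (g x : 'I_d -> R) m,
    (forall j, g j = m + x j - mxop Q x j) -> forall (u : R) j, 0 <= u ->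
    cmod (iter n (mxop (twist Q z (u / Num.sqrt n%:R))) (fun k => (g k)%:C) j -
      (m * expR (- (sigma * u ^+ 2 / 2)))%:C) @[n --> \oo] --> (0 : R).
Proof.
move=> yc; pose y j k := z j k + H k - H j.
have [sigma [w yv]] := poisson_equation i0 (fun j => \sum_k Q j k * y j k ^+ 2) Q0 Q1.
have sigma0 : 0 <= sigma.
  have [i hi] := ex_argmin i0 w.
  have h1 : 0 <= \sum_k Q i k * y i k ^+ 2.
    by apply: sumr_ge0 => k _; rewrite mulr_ge0 ?sqr_ge0// ltW.
  have h2 : w i <= mxop Q w i.
    rewrite -[leLHS]mul1r -(Q1 i) mulr_suml; apply: ler_sum => k _.
    by rewrite ler_wpM2l// ltW.
  by move: h1; rewrite yv; lra.
exists sigma => // g x m gE u j u0.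
have [C [s1 [C0 s10 happ]]] := twist_approx_eigenvector Q0 Q1 yc sigma0 yv.
have [W W0 hW] := fin_bounded w.
have [Y Y0 hY'] := fin_bounded (fun p : 'I_d * 'I_d => y p.1 p.2).
have hY i k : `|y i k| <= Y := hY' (i, k).
have [Hb Hb0 hH] := fin_bounded H.
have [G G0 hG] := fin_bounded g.
pose f k := g k - m.
have [F F0 hF] := fin_bounded f.
have fE k : f k = 0 + x k - mxop Q x k by rewrite /f gE; ring.
have [rho [D [rho0 rho1 hrho]]] := iter_mxop_cvg i0 Q0 Q1 fE.
pose K k : R := k%:R * (2 * Y * F) + `|m| * (C * u ^+ 2 + s1 * W) + 4 * Hb * G.
have main k n : (k <= n)%N -> (0 < n)%N -> u / Num.sqrt n%:R <= s1 ->
    cmod (iter n (mxop (twist Q z (u / Num.sqrt n%:R))) (fun k => (g k)%:C) j -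
      (m * expR (- (sigma * u ^+ 2 / 2)))%:C) <= rho ^+ k * D + K k * (u / Num.sqrt n%:R).
  move=> kn n0; set s := u / _ => ss1.
  have s0 : 0 <= s by rewrite divr_ge0.
  have ss : 0 <= s <= s1 by rewrite s0.
  have ns2 : n%:R * s ^+ 2 = u ^+ 2.
    by rewrite /s expr_div_n sqr_sqrtr// mulrCA divff ?mulr1// pnatr_eq0 -lt0n.
  pose T := mxop (twist Q y s).
  have qE : expR (- (sigma * u ^+ 2 / 2)) = expR (- (sigma * s ^+ 2 / 2)) ^+ n.
    by rewrite -expRM_natl -ns2; congr expR; ring.
  have e1 := iter_twist_one sigma0 hW happ n j ss.
  (* The first [k] applications nearly annihilate [f] by mixing; the other [n - k] do not increase
     the sup norm. *)
  have e2 : cmod (iter n T (fun k => (f k)%:C) j) <= rho ^+ k * D + k%:R * (2 * (s * Y) * F).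
    rewrite -(subnK kn) iterD; apply: cmod_iter_twist => // i.
    have h1 := iter_twist_real k i hY hF s0.
    have h2 := hrho k i; rewrite subr0 in h2.
    rewrite -[X in cmod X](subrK ((iter k (mxop Q) f i)%:C)).
    apply: le_trans (cmodD _ _) _; rewrite addrC; apply: lerD; last exact: h1.
    by rewrite cmod_real.
  have gfm : iter n T (fun k => (g k)%:C) j =
      iter n T (fun k => (f k)%:C) j + m%:C * iter n T (fun=> 1) j.
    rewrite -iter_mxop_linear; congr (iter n T _ j); apply/funext => i.
    by rewrite mulr1 /f -rmorphD subrK.
  have e3 : cmod (iter n T (fun k => (g k)%:C) j - (m * expR (- (sigma * u ^+ 2 / 2)))%:C) <=
      rho ^+ k * D + k%:R * (2 * (s * Y) * F) + `|m| * (n%:R * (C * s ^+ 3) + s ^+ 2 * W).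
    rewrite gfm qE rmorphM/= -addrA -mulrBr; apply: le_trans (cmodD _ _) _; apply: lerD => //.
    by rewrite cmodM cmod_real ler_wpM2l.
  rewrite (iter_twist_coboundary Q z H) -/y -/T.
  set X := iter n T (fun k => cis (- (s * H k)) * (g k)%:C) j.
  have cH k' : cmod (cis (- (s * H k')) - 1) <= 2 * (s * Hb).
    apply: le_trans (cmod_cis_sub1 _) _; rewrite ler_wpM2l// normrN normrM ger0_norm//.
    by rewrite ler_wpM2l.
  have cH' : cmod (cis (s * H j) - 1) <= 2 * (s * Hb).
    apply: le_trans (cmod_cis_sub1 _) _; rewrite ler_wpM2l// normrM ger0_norm//.
    by rewrite ler_wpM2l.
  have XG : cmod X <= G.
    apply: cmod_iter_twist => // k'; rewrite cmodM cmod_cis mul1r cmod_real; exact: hG.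
  have Xg : cmod (X - iter n T (fun k => (g k)%:C) j) <= 2 * (s * Hb) * G.
    apply: cmod_iter_twistB => // k'; rewrite -{2}[(g k')%:C]mul1r -mulrBl cmodM cmod_real.
    by rewrite ler_pM ?cmod_ge0.
  set Z := iter n T _ j in Xg e3; set L := (m * _)%:C in e3 *.
  have -> : cis (s * H j) * X - L = (Z - L) + ((cis (s * H j) - 1) * X + (X - Z)) by ring.
  apply: le_trans (cmodD _ _) _.
  have e4 : cmod ((cis (s * H j) - 1) * X + (X - Z)) <= 2 * (s * Hb) * G + 2 * (s * Hb) * G.
    apply: le_trans (cmodD _ _) _; apply: lerD => //.
    by rewrite cmodM ler_pM ?cmod_ge0.
  apply: le_trans (lerD e3 e4) _.
  have -> : n%:R * (C * s ^+ 3) = s * (C * u ^+ 2) by rewrite -ns2; ring.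
  have sW : s ^+ 2 * W <= s * (s1 * W) by rewrite expr2 -mulrA ler_wpM2l// ler_wpM2r.
  have mW : `|m| * (s * (C * u ^+ 2) + s ^+ 2 * W) <= `|m| * (s * (C * u ^+ 2) + s * (s1 * W)).
    by rewrite ler_wpM2l// lerD2l.
  have -> : rho ^+ k * D + K k * s = rho ^+ k * D + k%:R * (2 * (s * Y) * F) +
    `|m| * (s * (C * u ^+ 2) + s * (s1 * W)) + (2 * (s * Hb) * G + 2 * (s * Hb) * G).
    by rewrite /K; ring.
  by rewrite lerD2r lerD2l.
have s_cvg : u / Num.sqrt n%:R @[n --> \oo] --> (0 : R).
  rewrite -[X in _ --> X](mulr0 u); apply: cvgM; first exact: cvg_cst.
  exact: cvg_invsqrt.
apply/cvgrPdist_le => e e0.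
have e20 : 0 < e / 2 by rewrite divr_gt0.
have rhoD : rho ^+ k * D @[k --> \oo] --> (0 : R).
  rewrite -[X in _ --> X](mul0r D); apply: cvgM; last exact: cvg_cst.
  by apply: cvg_expr; rewrite ger0_norm.
(* [k] is fixed by the geometric term before [n] is sent to infinity in [K k * s]. *)
have [k _ hk] : \forall k \near \oo, `|0 - rho ^+ k * D| <= e / 2.
  by have /cvgrPdist_le := rhoD; apply.
have Ks : K k * (u / Num.sqrt n%:R) @[n --> \oo] --> (0 : R).
  rewrite -[X in _ --> X](mulr0 (K k)); apply: cvgM => //; exact: cvg_cst.
have n1 : \forall n \near \oo, `|0 - K k * (u / Num.sqrt n%:R)| <= e / 2.
  by have /cvgrPdist_le := Ks; apply.
have n2 : \forall n \near \oo, `|0 - u / Num.sqrt n%:R| <= s1.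
  by have /cvgrPdist_le := s_cvg; apply.
near=> n.
have m1 : `|0 - K k * (u / Num.sqrt n%:R)| <= e / 2 by near: n.
have m2 : `|0 - u / Num.sqrt n%:R| <= s1 by near: n.
have kn : (k < n)%N by near: n; exact: nbhs_infty_gt.
have := main k n (ltnW kn) (leq_trans (ltn0Sn k) kn).
rewrite sub0r normrN in m2; move=> /(_ (le_trans (ler_norm _) m2)) h.
rewrite sub0r normrN (ger0_norm (cmod_ge0 _)); apply: le_trans h _.
have := hk k (leqnn _); rewrite /= sub0r normrN.
have := ler_norm (rho ^+ k * D); have := ler_norm (K k * (u / Num.sqrt n%:R)).
by rewrite sub0r normrN in m1; lra.
Unshelve. all: by end_near. Qed.

End TwistLimit.

(** * Sums over paths *)

Section PathSums.
Variables (K : comNzRingType) (I : finType).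

Definition path_cons n (j : I) (y : {ffun 'I_n.+1 -> I}) : {ffun 'I_n.+2 -> I} :=
  [ffun i => if unlift ord0 i is Some k then y k else j].

Lemma path_cons0 n j (y : {ffun 'I_n.+1 -> I}) : path_cons j y ord0 = j.
Proof. by rewrite ffunE unlift_none. Qed.

Lemma path_consS n j (y : {ffun 'I_n.+1 -> I}) i : (i < n.+1)%N ->
  path_cons j y (inord i.+1) = y (inord i).
Proof.
move=> ltin; have -> : inord i.+1 = lift ord0 (inord i : 'I_n.+1).
  by apply: val_inj; rewrite /= inordK//= inordK.
by rewrite ffunE liftK.
Qed.

Lemma inord0 n : inord 0 = ord0 :> 'I_n.+1.
Proof. by apply: val_inj; rewrite /= inordK. Qed.

Lemma inord_max n : inord n = ord_max :> 'I_n.+1.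
Proof. by apply: val_inj; rewrite /= inordK. Qed.

Lemma big_path_cons n (G : {ffun 'I_n.+2 -> I} -> K) :
  \sum_x G x = \sum_j \sum_y G (path_cons j y).
Proof.
rewrite pair_big/= (reindex (fun p : I * {ffun 'I_n.+1 -> I} => path_cons p.1 p.2))//.
exists (fun x : {ffun 'I_n.+2 -> I} => (x ord0, [ffun i : 'I_n.+1 => x (lift ord0 i)])) => [[j y] _|x _] /=.
  by rewrite path_cons0; congr pair; apply/ffunP => i; rewrite !ffunE liftK.
by apply/ffunP => i; rewrite ffunE; case: unliftP => [k ->|->] //; rewrite ffunE.
Qed.

Lemma path_sum n (a g : I -> K) (W : I -> I -> K) :
  \sum_(x : {ffun 'I_n.+1 -> I}) a (x ord0) *
    (\prod_(i < n) W (x (inord i)) (x (inord i.+1))) * g (x ord_max) =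
  \sum_j a j * iter n (mxop W) g j.
Proof.
elim: n a => [|n ih] a.
  rewrite (reindex (fun j : I => [ffun _ : 'I_1 => j])).
    by apply: eq_bigr => j _; rewrite big_ord0 mulr1 !ffunE.
  exists (fun x : {ffun 'I_1 -> I} => x ord0) => [j _|x _]; first by rewrite ffunE.
  by apply/ffunP => i; rewrite /= ffunE (ord1 i); congr (x _); exact: val_inj.
rewrite big_path_cons; apply: eq_bigr => j _.
transitivity (\sum_(y : {ffun 'I_n.+1 -> I}) (a j * W j (y ord0)) *
    (\prod_(i < n) W (y (inord i)) (y (inord i.+1))) * g (y ord_max)).
  apply: eq_bigr => y _; rewrite big_ord_recl -!inord_max path_consS// path_cons0 inord0 path_cons0.
  rewrite -!mulrA; congr (_ * _); rewrite path_consS// inord0; congr (_ * _); congr (_ * _).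
  apply: eq_bigr => i _; have ltin := ltn_ord i.
  by rewrite !path_consS// ltnS// ltnW.
transitivity (\sum_k a j * W j k * iter n (mxop W) g k); first exact: ih.
rewrite iterS /mxop mulr_sumr.
by apply: eq_bigr => k _; rewrite mulrA.
Qed.

(** [SN] starts at time [1], so the initial transition carries the plain [P] and is absorbed into
    the starting weight. *)
Lemma path_sum_shift n (a g : I -> K) (P W : I -> I -> K) :
  \sum_(x : {ffun 'I_n.+2 -> I}) a (x ord0) * P (x (inord 0)) (x (inord 1)) *
    (\prod_(i < n) W (x (inord i.+1)) (x (inord i.+2))) * g (x ord_max) =
  \sum_k (\sum_j a j * P j k) * iter n (mxop W) g k.
Proof.
rewrite big_path_cons exchange_big -(path_sum n (fun k => \sum_j a j * P j k)); apply: eq_bigr => y _.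
rewrite -[RHS]mulrA mulr_suml; apply: eq_bigr => j _.
rewrite -!inord_max path_consS// inord0 path_cons0 path_consS// inord0 -mulrA; congr (_ * (_ * _)).
apply: eq_bigr => i _; have ltin := ltn_ord i.
by rewrite !path_consS// ltnS// ltnW.
Qed.

End PathSums.

Section MarkovSums.
Context {R : realType} (d : nat) (mu : 'I_d -> R) (P h : 'M[R]_d).

Lemma SN_ord N (x : {ffun 'I_N.+2 -> 'I_d}) :
  SN h x = \sum_(i < N) h (x (inord i.+1)) (x (inord i.+2)).
Proof. by rewrite /SN big_add1 big_mkord. Qed.

Lemma path_prob_recl N (x : {ffun 'I_N.+2 -> 'I_d}) :
  path_prob mu P x = mu (x ord0) * P (x (inord 0)) (x (inord 1)) *
    \prod_(i < N) P (x (inord i.+1)) (x (inord i.+2)).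
Proof. by rewrite /path_prob big_ord_recl mulrA. Qed.

(** The law of [x_1]. *)
Definition start_weight k := \sum_j mu j * P j k.

Definition tilt t : 'I_d -> 'I_d -> R := fun j k => P j k * expR (t * h j k).

Lemma expect_exp t N : expect mu P (fun x => expR (t * @SN R d h N x)) =
  \sum_k start_weight k * iter N (mxop (tilt t)) (fun=> 1) k.
Proof.
rewrite /start_weight -(path_sum_shift _ _ (fun=> 1)); apply: eq_bigr => x _.
rewrite mulr1 path_prob_recl -mulrA; congr (_ * _).
by rewrite SN_ord mulr_sumr expR_sum -big_split.
Qed.

Lemma expect_cst1 N : (forall j, \sum_k P j k = 1) -> \sum_i mu i = 1 ->
  expect mu P (fun _ : {ffun 'I_N.+2 -> 'I_d} => 1) = 1.
Proof.
move=> P1 mu1.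
have iter1 k : iter N (mxop (fun j k => P j k)) (fun=> 1) k = 1.
  elim: (N) k => [//|n ih] k; rewrite iterS /mxop.
  by under eq_bigr do rewrite ih mulr1; exact: P1.
transitivity (\sum_k start_weight k * iter N (mxop (fun j k => P j k)) (fun=> 1) k).
  rewrite /start_weight -(path_sum_shift _ _ (fun=> 1)); apply: eq_bigr => x _.
  by rewrite !mulr1 path_prob_recl.
under eq_bigr do rewrite iter1 mulr1.
rewrite /start_weight exchange_big -[RHS]mu1; apply: eq_bigr => j _.
by rewrite -mulr_sumr P1 mulr1.
Qed.

Lemma path_prod_le_iter (W : 'I_d -> 'I_d -> R) n (x : {ffun 'I_n.+1 -> 'I_d}) :
  (forall j k, 0 <= W j k) ->
  \prod_(i < n) W (x (inord i)) (x (inord i.+1)) <= iter n (mxop W) (fun=> 1) (x ord0).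
Proof.
move=> W0; have := path_sum n (fun j => (j == x ord0)%:R) (fun=> 1) W.
have -> : \sum_j (j == x ord0)%:R * iter n (mxop W) (fun=> 1) j =
    iter n (mxop W) (fun=> 1) (x ord0).
  by rewrite (bigD1 (x ord0))//= eqxx mul1r big1 ?addr0// => j /negbTE->; rewrite mul0r.
move=> <-.
rewrite (bigD1 x)//= eqxx mul1r mulr1 lerDl; apply: sumr_ge0 => y _.
by rewrite mulr1 mulr_ge0// prodr_ge0.
Qed.

End MarkovSums.

(** * The tilted chain and the limit defining [Lambda] *)

Section CharacteristicFunction.
Context {R : realType} (d : nat) (mu : 'I_d -> R) (P h : 'M[R]_d).
Hypothesis mu0 : forall i, 0 <= mu i.
Hypothesis mu1 : \sum_i mu i = 1.
Hypothesis P0 : forall j k, 0 < P j k.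
Hypothesis P1 : forall j, \sum_k P j k = 1.

Lemma tilt_gt0 t j k : 0 < tilt P h t j k.
Proof. by rewrite mulr_gt0 ?expR_gt0. Qed.

Lemma start_weight_ge0 k : 0 <= start_weight mu P k.
Proof. by apply: sumr_ge0 => j _; rewrite mulr_ge0// ltW. Qed.

Lemma sum_start_weight : \sum_k start_weight mu P k = 1.
Proof.
rewrite /start_weight exchange_big -[RHS]mu1; apply: eq_bigr => j _.
by rewrite -mulr_sumr P1 mulr1.
Qed.

Lemma path_prob_ge0 n (x : {ffun 'I_n.+1 -> 'I_d}) : 0 <= path_prob mu P x.
Proof. by rewrite mulr_ge0// prodr_ge0// => i _; rewrite ltW. Qed.

Lemma cis_sum (I : finType) (f : I -> R) : cis (\sum_i f i) = \prod_i cis (f i).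
Proof. by apply: (big_morph (@cis R)); [exact: cisD|exact: cis0]. Qed.

Section Doob.
Variables (t l a : R) (u : 'I_d -> R).
Hypothesis u0 : forall j, 0 < u j.
Hypothesis u_eigen : forall j, mxop (tilt P h t) u j = expR l * u j.

Definition doob j k : R := tilt P h t j k * u k / (expR l * u j).

Lemma doob_gt0 j k : 0 < doob j k.
Proof. by rewrite divr_gt0 ?mulr_gt0 ?tilt_gt0 ?expR_gt0. Qed.

Lemma sum_doob j : \sum_k doob j k = 1.
Proof.
by rewrite -mulr_suml -/(mxop (tilt P h t) u j) u_eigen divff// gt_eqF// mulr_gt0 ?expR_gt0.
Qed.

(** The matrix of path weights is the twisted Doob matrix conjugated by the diagonal [u]. The
    eigenvector therefore survives only at the ends, as [u] in the initial weight and [u^-1] in the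
    terminal function. *)
Lemma char_path N s :
  \sum_(x : {ffun 'I_N.+2 -> 'I_d})
    (path_prob mu P x * expR (t * SN h x - l * N%:R))%:C * cis (s * (SN h x - a * N%:R)) =
  \sum_k (start_weight mu P k * u k)%:C *
    iter N (mxop (twist doob (fun j k => h j k - a) s)) (fun k => ((u k)^-1)%:C) k.
Proof.
pose W j k : R[i] := (P j k * expR (t * h j k - l))%:C * cis (s * (h j k - a)).
have gauge n k : iter n (mxop W) (fun=> 1) k =
    (u k)%:C * iter n (mxop (twist doob (fun j k => h j k - a) s)) (fun k => ((u k)^-1)%:C) k.
  elim: n k => [|n ih] k.
    by rewrite /= -rmorphM/= divff// gt_eqF.
  rewrite !iterS /mxop mulr_sumr; apply: eq_bigr => k' _; rewrite ih /W /twist.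
  have -> : P k k' * expR (t * h k k' - l) = u k * doob k k' * (u k')^-1.
    rewrite /doob /tilt expRD expRN; field.
    by rewrite !gt_eqF// expR_gt0.
  rewrite mulrA [in RHS]mulrA [in RHS]mulrA; congr (_ * _).
  rewrite mulrAC -!rmorphM/= mulrC.
  have uk : u k' != 0 by rewrite gt_eqF.
  by rewrite divfK // mulrC.
transitivity (\sum_k (\sum_j (mu j)%:C * (P j k)%:C) * iter N (mxop W) (fun=> 1) k).
  rewrite -(path_sum_shift N (fun j => (mu j)%:C) (fun=> 1) (fun j k => (P j k)%:C)).
  apply: eq_bigr => x _; rewrite mulr1 path_prob_recl.
  have -> : t * SN h x - l * N%:R = \sum_(i < N) (t * h (x (inord i.+1)) (x (inord i.+2)) - l).
    by rewrite SN_ord sumrB sumr_const card_ord mulr_sumr mulr_natr.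
  have -> : s * (SN h x - a * N%:R) =
      \sum_(i < N) (s * (h (x (inord i.+1)) (x (inord i.+2)) - a)).
    by rewrite SN_ord -mulr_sumr sumrB sumr_const card_ord mulr_natr.
  rewrite expR_sum cis_sum.
  set p1 := \prod_(i < N) P _ _; set p2 := \prod_(i < N) expR _; set p3 := \prod_(i < N) cis _.
  have -> : \prod_(i < N) W (x (inord i.+1)) (x (inord i.+2)) = p1%:C * p2%:C * p3.
    by rewrite -rmorphM /p1 /p2 -big_split rmorph_prod -big_split.
  rewrite !rmorphM/=; ring.
apply: eq_bigr => k _; rewrite gauge mulrA rmorphM/=; congr (_ * _ * _).
by rewrite /start_weight rmorph_sum; apply: eq_bigr => j _; rewrite rmorphM.
Qed.

End Doob.

Lemma expect_exp_growth (i0 : 'I_d) t lam u : (forall j, 0 < u j) ->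
  (forall j, mxop (tilt P h t) u j = lam * u j) ->
  exists c C : R, [/\ 0 < c, 0 < C & forall N,
    c * lam ^+ N <= expect mu P (fun x => expR (t * @SN R d h N x)) <= C * lam ^+ N].
Proof.
move=> u0 ue; have W0 j k : 0 <= tilt P h t j k by rewrite ltW// tilt_gt0.
have [c [C [c0 C0 H]]] := iter_mxop_growth i0 W0 u0 ue.
have avg (r : R) : r = \sum_k start_weight mu P k * r.
  by rewrite -mulr_suml sum_start_weight mul1r.
exists c, C; split => // N; rewrite expect_exp (avg (c * _)) (avg (C * _)).
apply/andP; split; apply: ler_sum => k _; rewrite ler_wpM2l ?start_weight_ge0//;
  by case/andP: (H N k).
Qed.

(** Constant factors disappear after [ln] and division by [N]. This also shows that the [limn] in
    [Lambda] is a genuine limit, not a default value. *)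
Lemma Lambda_cvg (i0 : 'I_d) t lam u : 0 < lam -> (forall j, 0 < u j) ->
  (forall j, mxop (tilt P h t) u j = lam * u j) ->
  ln (expect mu P (fun x => expR (t * @SN R d h N x))) / N%:R @[N --> \oo] --> ln lam.
Proof.
move=> lam0 u0 ue; have [c [C [c0 C0 H]]] := expect_exp_growth i0 u0 ue.
pose E N := expect mu P (fun x => expR (t * @SN R d h N x)).
pose K := `|ln c| + `|ln C|.
have main N : (0 < N)%N -> `|ln lam - ln (E N) / N%:R| <= K * N%:R^-1.
  move=> N0; have N0' : 0 < N%:R :> R by rewrite ltr0n.
  have /andP[h1 h2] := H N; rewrite -/(E N) in h1 h2.
  have ln0 : 0 < lam ^+ N by exact: exprn_gt0.
  have E0 : 0 < E N by rewrite (lt_le_trans _ h1)// mulr_gt0.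
  have e1 : ln c + ln lam * N%:R <= ln (E N).
    by rewrite mulr_natr -lnXn// -lnM ?posrE// ler_ln ?posrE// mulr_gt0.
  have e2 : ln (E N) <= ln C + ln lam * N%:R.
    by rewrite mulr_natr -lnXn// -lnM ?posrE// ler_ln ?posrE// mulr_gt0.
  have -> : ln lam - ln (E N) / N%:R = (ln lam * N%:R - ln (E N)) / N%:R.
    by rewrite mulrBl mulfK// gt_eqF.
  have iN : 0 <= N%:R^-1 :> R by rewrite invr_ge0 ltW.
  rewrite normrM (ger0_norm iN) ler_wpM2r//.
  rewrite /K; have := ler_norm (ln C); have := ler_norm (- ln c); rewrite normrN => k1 k2.
  have := normr_ge0 (ln c); have := normr_ge0 (ln C).
  by rewrite ler_norml => k3 k4; apply/andP; split; lra.
apply/cvgrPdist_le => e e0.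
have hK : K * N%:R^-1 @[N --> \oo] --> (0 : R).
  rewrite -[X in _ --> X](mulr0 K); apply: cvgM; first exact: cvg_cst.
  by rewrite -(cvg_shiftS _ (nbhs (0 : R))); exact: cvg_harmonic.
have n1 : \forall N \near \oo, `|0 - K * N%:R^-1| <= e.
  by have /cvgrPdist_le := hK; apply.
near=> N.
have m1 : `|0 - K * N%:R^-1| <= e by near: N.
have N0 : (0 < N)%N by near: N; exact: nbhs_infty_gt.
apply: le_trans (main N N0) _; apply: le_trans (ler_norm _) _.
by rewrite sub0r normrN in m1.
Unshelve. all: by end_near. Qed.

Lemma LambdaE (i0 : 'I_d) t lam u : 0 < lam -> (forall j, 0 < u j) ->
  (forall j, mxop (tilt P h t) u j = lam * u j) -> Lambda mu P h t = ln lam.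
Proof. by move=> lam0 u0 ue; apply: cvg_lim => //; exact: (Lambda_cvg i0 lam0 u0 ue). Qed.

End CharacteristicFunction.

(** * The pressure function *)

Section Pressure.
Context {R : realType} (d : nat) (i0 : 'I_d) (mu : 'I_d -> R) (P h : 'M[R]_d).
Hypothesis mu0 : forall i, 0 <= mu i.
Hypothesis mu1 : \sum_i mu i = 1.
Hypothesis P0 : forall j k, 0 < P j k.
Hypothesis P1 : forall j, \sum_k P j k = 1.
Local Notation L := (Lambda mu P h).
Local Notation E f := (expect mu P f).

Lemma Lambda_eigen t : exists2 u : 'I_d -> R, forall j, 0 < u j &
  forall j, mxop (tilt P h t) u j = expR (L t) * u j.
Proof.
have [lam [u [lam0 u0 ue]]] := perron i0 (tilt_gt0 h P0 t).
by exists u => // j; rewrite (LambdaE mu0 mu1 P0 P1 i0 lam0 u0 ue) lnK ?posrE.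
Qed.

Lemma Lambda_is_cvg t :
  ln (E (fun x => expR (t * @SN R d h N x))) / N%:R @[N --> \oo] --> L t.
Proof.
have [u u0 ue] := Lambda_eigen t.
by have := Lambda_cvg mu0 mu1 P0 P1 i0 (expR_gt0 (L t)) u0 ue; rewrite expRK.
Qed.

Lemma Lambda_le t rho v : (forall j, 0 < v j) ->
  (forall j, mxop (tilt P h t) v j <= expR rho * v j) -> L t <= rho.
Proof.
move=> v0 hv; have [u u0 ue] := Lambda_eigen t.
rewrite -ler_expR; apply: (collatz_wielandt_le i0 _ u0 ue v0 hv) => j k.
by rewrite ltW// tilt_gt0.
Qed.

Lemma Lambda0 : L 0 = 0.
Proof.
rewrite -[RHS]ln1; apply: (LambdaE mu0 mu1 P0 P1 i0 (u := fun=> 1)) => // j.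
rewrite /mxop mul1r -[RHS](P1 j); apply: eq_bigr => k _.
by rewrite /tilt mul0r expR0 !mulr1.
Qed.

(** The eigenvector at [s] is a test vector at [t], because tilting from [s] to [t] multiplies each
    entry by at most [expR (M |t - s|)]. *)
Lemma Lambda_lipschitz : exists2 M, 0 <= M & forall s t, L t <= L s + M * `|t - s|.
Proof.
have [M M0 hM'] := fin_bounded (fun p : 'I_d * 'I_d => h p.1 p.2).
have hM j k : `|h j k| <= M := hM' (j, k).
exists M => // s t; have [u u0 ue] := Lambda_eigen s.
apply: (Lambda_le u0) => j; rewrite expRD mulrAC -ue /mxop mulr_suml.
apply: ler_sum => k _; rewrite [leRHS]mulrAC; apply: ler_wpM2r; first exact: ltW.
rewrite /tilt -mulrA ler_wpM2l ?(ltW (P0 _ _))// -expRD ler_expR.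
have : (t - s) * h j k <= M * `|t - s|.
  by rewrite (le_trans (ler_norm _))// normrM mulrC ler_wpM2r.
lra.
Qed.

Lemma continuous_Lambda : continuous L.
Proof.
have [M M0 hM] := Lambda_lipschitz.
have M1 : 0 < M + 1 by lra.
move=> t; apply/cvgrPdist_le => e e0; near=> s.
have h1 : `|t - s| <= e / (M + 1).
  by near: s; apply: cvgr_dist_le; [exact: cvg_id|exact: divr_gt0].
have h2 : M * `|t - s| <= e.
  move: h1; rewrite ler_pdivlMr// => h1; apply: le_trans h1.
  by rewrite mulrC ler_wpM2l// lerDl.
have := hM s t; have := hM t s; rewrite (distrC s t) ler_norml.
move: (L s) (L t) (M * _) h2 => a b c h2 h3 h4.
by apply/andP; split; lra.
Unshelve. all: by end_near. Qed.

(** With [x] the Poisson corrector of the tilted increments, the test vector [u_j expR (s x_j)]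
    makes the first-order term the same constant [m] in every row; [expR_le_quad] bounds the
    rest. *)
Lemma Lambda_quadratic t u : (forall j, 0 < u j) ->
  (forall j, mxop (tilt P h t) u j = expR (L t) * u j) ->
  exists m x Y, [/\ 0 <= Y,
    forall j, \sum_k doob P h t (L t) u j k * (h j k + x k - x j) = m &
    forall s, `|s| * Y <= 1 / 2 -> L (t + s) <= L t + s * m + 2 * s ^+ 2 * Y ^+ 2].
Proof.
move=> u0 ue; set Q := doob P h t (L t) u.
have Q0 j k : 0 < Q j k by exact: doob_gt0.
have Q1 j : \sum_k Q j k = 1 by exact: sum_doob.
have [m [x hx]] := poisson_equation i0 (fun j => \sum_k Q j k * h j k) Q0 Q1.
have [Y Y0 hY'] := fin_bounded (fun p : 'I_d * 'I_d => h p.1 p.2 + x p.2 - x p.1).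
have hY j k : `|h j k + x k - x j| <= Y := hY' (j, k).
have hm j : \sum_k Q j k * (h j k + x k - x j) = m.
  transitivity (\sum_k Q j k * h j k + mxop Q x j - (\sum_k Q j k) * x j).
    by rewrite /mxop mulr_suml -big_split -sumrB; apply: eq_bigr => k _; rewrite /= mulrBr mulrDr.
  by rewrite hx Q1; ring.
exists m, x, Y; split => // s sY.
apply: (@Lambda_le _ _ (fun j => u j * expR (s * x j))) => [j|j].
  by rewrite mulr_gt0// expR_gt0.
have E1 : mxop (tilt P h (t + s)) (fun j => u j * expR (s * x j)) j =
    expR (L t) * (u j * expR (s * x j)) * \sum_k Q j k * expR (s * (h j k + x k - x j)).
  rewrite /mxop mulr_sumr; apply: eq_bigr => k _.
  rewrite /Q /doob /tilt mulrDl expRD mulrBr mulrDr expRB expRD; field.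
  by rewrite !gt_eqF// expR_gt0.
rewrite E1 -addrA expRD mulrAC ler_wpM2r ?mulr_ge0 ?expR_ge0 ?(ltW (u0 _))//.
  rewrite ler_wpM2l ?expR_ge0//.
  apply: (@le_trans _ _ (1 + (s * m + 2 * s ^+ 2 * Y ^+ 2))); last exact: expR_ge1Dx.
  have -> : 1 + (s * m + 2 * s ^+ 2 * Y ^+ 2) = \sum_k Q j k *
      (1 + s * (h j k + x k - x j) + 2 * s ^+ 2 * Y ^+ 2).
    transitivity (\sum_k Q j k + s * (\sum_k Q j k * (h j k + x k - x j)) +
      (\sum_k Q j k) * (2 * s ^+ 2 * Y ^+ 2)).
      by rewrite Q1 hm; ring.
    by rewrite mulr_sumr mulr_suml -!big_split; apply: eq_bigr => k _ /=; ring.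
  apply: ler_sum => k _; rewrite ler_wpM2l ?(ltW (Q0 _ _))//.
  have sy : `|s * (h j k + x k - x j)| <= `|s| * Y by rewrite normrM ler_wpM2l.
  apply: le_trans (expR_le_quad (le_trans sy sY)) _; rewrite lerD2l.
  rewrite -mulrA ler_wpM2l// -exprMn -real_normK ?num_real//.
  rewrite -[leRHS]real_normK ?num_real// lerXn2r ?nnegrE//.
  by rewrite [leRHS]normrM (ger0_norm Y0).
Qed.

(** Jensen's inequality for [expR], obtained from [1 + y <= expR y] at [y = s S_N - s E(S_N)], turns
    zero drift into nonnegativity. *)
Lemma Lambda_jensen :
  (fun N : nat => E (@SN R d h N) / N%:R) @ \oo --> (0 : R) -> forall s, 0 <= L s.
Proof.
move=> hE s.
have hs : s * (E (@SN R d h N) / N%:R) @[N --> \oo] --> (0 : R).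
  rewrite -[X in _ --> X](mulr0 s); apply: cvgM => //; exact: cvg_cst.
have := ler_cvg_to hs (@Lambda_is_cvg s); apply.
near=> N.
rewrite mulrA ler_wpM2r ?invr_ge0//.
set e := s * E _.
have E0 : 1 <= E (fun x => expR (s * @SN R d h N x)) * expR (- e).
  rewrite /expect mulr_suml.
  have -> : 1 = \sum_(x : {ffun 'I_N.+2 -> 'I_d}) path_prob mu P x * (1 + (s * SN h x - e)).
    have e1 : \sum_(x : {ffun 'I_N.+2 -> 'I_d}) path_prob mu P x = 1.
      rewrite -(@expect_cst1 _ _ mu P N P1 mu1).
      by apply: eq_bigr => x _; rewrite mulr1.
    under [RHS]eq_bigr do rewrite mulrDr mulr1 mulrBr mulrCA.
    rewrite big_split sumrB -mulr_sumr -mulr_suml e1 mul1r /= /e /expect; ring.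
  apply: ler_sum => x _; rewrite -mulrA -expRD ler_wpM2l ?path_prob_ge0//.
  exact: expR_ge1Dx.
have X0 : 0 < E (fun x => expR (s * @SN R d h N x)).
  by rewrite -(pmulr_lgt0 _ (expR_gt0 (- e))) (lt_le_trans _ E0).
rewrite -[e]expRK ler_ln ?posrE ?expR_gt0//.
by rewrite -[leLHS]mul1r -ler_pdivlMr ?expR_gt0// -expRN.
Unshelve. all: by end_near. Qed.

(** A single path of [n] steps with [h]-sum above [b n] has transition product at least [p^n], where
    [p] is the least entry of [P]; it alone forces growth at rate [t b + ln p]. *)
Lemma Lambda_ge_Bconst b : 0 < b -> b < Bconst h ->
  exists q, forall t, 0 <= t -> t * b - q <= L t.
Proof.
move=> b0 bB.
have cB : cvgn (fun n => Bn h n / n%:R).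
  (* If [Bn h n / n] diverged, [limn] would return the default [0], against [0 < b < Bconst h]. *)
  apply: contrapT => /dvgP lim0; move: bB; rewrite /Bconst lim0.
  by rewrite -[point]/(0 : R) ltNge ltW.
have nearB : \forall n \near \oo, b < Bn h n / n%:R by exact: (cvgr_gt _ cB _ bB).
have [pm hpm] := ex_argmin (i0, i0) (fun p : 'I_d * 'I_d => P p.1 p.2).
set p := P pm.1 pm.2; have p0 : 0 < p by exact: P0.
have hp j k : p <= P j k by exact: (hpm (j, k)).
exists (- ln p) => t t0; rewrite opprK.
have [u u0 ue] := Lambda_eigen t.
have W0 j k : 0 <= tilt P h t j k by rewrite ltW// tilt_gt0.
have [c [C [c0 C0 H]]] := iter_mxop_growth i0 W0 u0 ue.
have hL : L t + ln C * n%:R^-1 @[n --> \oo] --> L t.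
  rewrite -[X in _ --> X]addr0; apply: cvgD; first exact: cvg_cst.
  rewrite -[X in _ --> X](mulr0 (ln C)); apply: cvgM; first exact: cvg_cst.
  by rewrite -(cvg_shiftS _ (nbhs (0 : R))); exact: cvg_harmonic.
apply: (cvgr_to_ge hL); near=> n.
have n0 : (0 < n)%N by near: n; exact: nbhs_infty_gt.
have n0' : 0 < n%:R :> R by rewrite ltr0n.
have bn : b < Bn h n / n%:R by near: n.
rewrite ltr_pdivlMr// in bn.
have [|_ [x ->] bx] := sup_gt _ bn; first by eexists; exists [ffun=> i0].
rewrite big_add1 big_mkord in bx.
have h1 := path_prod_le_iter x W0.
have h2 : p ^+ n * expR (t * (b * n%:R)) <=
    \prod_(i < n) tilt P h t (x (inord i)) (x (inord i.+1)).
  rewrite /tilt big_split/= -expR_sum -mulr_sumr; apply: ler_pM; rewrite ?expR_ge0//.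
  - by rewrite exprn_ge0// ltW.
  - rewrite -[n in p ^+ n]card_ord -prodr_const; apply: ler_prod => i _.
    by rewrite (ltW p0) hp.
  - by rewrite ler_expR ler_wpM2l// ltW.
have /andP[_ h3] := H n (x ord0).
have := le_trans h2 (le_trans h1 h3).
rewrite -expRM_natl -ler_ln ?posrE ?mulr_gt0 ?expR_gt0 ?exprn_gt0//.
rewrite !lnM ?posrE ?expR_gt0 ?exprn_gt0// !expRK lnXn// => h4.
rewrite -(ler_pM2r n0') !mulrDl mulrVK ?unitfE ?gt_eqF//.
by rewrite -mulrA; move: h4; rewrite -mulr_natr; lra.
Unshelve. all: by end_near. Qed.

End Pressure.

(** * The saddle point *)

Section Saddle.
Context {R : realType} (d : nat) (i0 : 'I_d) (mu : 'I_d -> R) (P h : 'M[R]_d).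
Hypothesis mu0 : forall i, 0 <= mu i.
Hypothesis mu1 : \sum_i mu i = 1.
Hypothesis P0 : forall j k, 0 < P j k.
Hypothesis P1 : forall j, \sum_k P j k = 1.
Local Notation L := (Lambda mu P h).

Lemma drift_le0 (m Y : R) : 0 <= Y ->
  (forall s, `|s| * Y <= 1 / 2 -> 0 <= s * m + 2 * s ^+ 2 * Y ^+ 2) -> m = 0.
Proof.
move=> Y0 H; apply/eqP; rewrite -normr_eq0; apply/negP => /negP m0.
have {}m0 : 0 < `|m| by rewrite lt_def m0 normr_ge0.
(* Opposite in sign to [m]: the first bound on the size respects the constraint on [s], the second
   keeps the quadratic term below half of [|s m|]. *)
pose s := - Num.sg m * Num.min (1 / (2 * (Y + 1))) (`|m| / (4 * (Y + 1) ^+ 2)).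
have Y1 : 0 < Y + 1 by lra.
set r := Num.min _ _ in s.
have r0 : 0 < r by rewrite lt_min !divr_gt0 ?mulr_gt0 ?exprn_gt0.
have sr : `|s| = r.
  by rewrite /s normrM normrN normr_sg -normr_eq0 gt_eqF// mul1r gtr0_norm.
have r1 : r * (Y + 1) <= 1 / 2.
  have : r <= 1 / (2 * (Y + 1)) by rewrite ge_min lexx.
  rewrite ler_pdivlMr ?mulr_gt0//; lra.
have r2 : r * (Y + 1) ^+ 2 <= `|m| / 4.
  have : r <= `|m| / (4 * (Y + 1) ^+ 2) by rewrite ge_min lexx orbT.
  rewrite ler_pdivlMr ?mulr_gt0 ?exprn_gt0//; lra.
have := H s; rewrite sr => /(_ _).
have -> : s * m = - (r * `|m|) by rewrite /s normrEsg; ring.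
have -> : s ^+ 2 = r ^+ 2 by rewrite -[in RHS]sr real_normK ?num_real.
have rY : r * Y <= 1 / 2 by rewrite (le_trans _ r1)// ler_pM2l// lerDl.
move=> /(_ rY); apply/negP; rewrite -ltNge.
have : r * (r * Y ^+ 2) <= r * (`|m| / 4).
  rewrite ler_pM2l// (le_trans _ r2)// ler_pM2l// lerXn2r ?nnegrE ?(ltW Y1)// lerDl//.
have : 0 < r * `|m| by rewrite mulr_gt0.
lra.
Qed.

(** [Lambda] is nonnegative and vanishes at [0], so the slope in its quadratic bound there must be
    zero. *)
Lemma Lambda_near0 :
  (fun N : nat => expect mu P (@SN R d h N) / N%:R) @ \oo --> (0 : R) ->
  exists2 Y, 0 <= Y & forall s, `|s| * Y <= 1 / 2 -> L s <= 2 * s ^+ 2 * Y ^+ 2.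
Proof.
move=> hE; have hL := Lambda_jensen i0 mu0 mu1 P0 P1 hE.
have [u u0 ue] := Lambda_eigen i0 h mu0 mu1 P0 P1 0.
have [m [x [Y [Y0 _ H]]]] := Lambda_quadratic i0 mu0 mu1 P0 P1 u0 ue.
have L0 := Lambda0 i0 h mu0 mu1 P0 P1.
have m0 : m = 0.
  apply: (drift_le0 Y0) => s sY; have := H s sY; rewrite add0r L0 add0r.
  exact: le_trans.
by exists Y => // s sY; have := H s sY; rewrite m0 mulr0 add0r L0 !add0r.
Qed.

Lemma exists_saddle a : 0 < a -> a < Bconst h ->
  (fun N : nat => expect mu P (@SN R d h N) / N%:R) @ \oo --> (0 : R) ->
  exists2 t, 0 < t & forall s, 0 <= s -> a * s - L s <= a * t - L t.
Proof.
move=> a0 aB hE; have L0 := Lambda0 i0 h mu0 mu1 P0 P1.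
have [Y Y0 hY] := Lambda_near0 hE.
have Y1 : 0 < Y + 1 by lra.
pose phi s := a * s - L s.
(* Small enough for [a s0] to beat the quadratic bound on [Lambda s0]. *)
pose s0 := Num.min (1 / (2 * (Y + 1))) (a / (4 * (Y + 1) ^+ 2)).
have s00 : 0 < s0 by rewrite lt_min !divr_gt0 ?mulr_gt0 ?exprn_gt0.
have phi_pos : 0 < phi s0.
  have r1 : s0 * (Y + 1) <= 1 / 2.
    have : s0 <= 1 / (2 * (Y + 1)) by rewrite ge_min lexx.
    rewrite ler_pdivlMr ?mulr_gt0//; lra.
  have r2 : s0 * (Y + 1) ^+ 2 <= a / 4.
    have : s0 <= a / (4 * (Y + 1) ^+ 2) by rewrite ge_min lexx orbT.
    rewrite ler_pdivlMr ?mulr_gt0 ?exprn_gt0//; lra.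
  have sY : `|s0| * Y <= 1 / 2.
    by rewrite gtr0_norm// (le_trans _ r1)// ler_pM2l// lerDl.
  have := hY s0 sY; rewrite /phi.
  have : s0 * (s0 * Y ^+ 2) <= s0 * (a / 4).
    rewrite ler_pM2l// (le_trans _ r2)// ler_pM2l// lerXn2r ?nnegrE ?(ltW Y1)// lerDl//.
  have : 0 < s0 * a by rewrite mulr_gt0.
  move: (L s0) => l; lra.
(* A slope strictly above [a] makes [phi s <= q - s (b - a)], which is nonpositive from [M] on and
   confines the maximum to [[0, M]]. *)
pose b := (a + Bconst h) / 2.
have ab : a < b by rewrite /b; lra.
have bB : b < Bconst h by rewrite /b; lra.
have [q hq] := Lambda_ge_Bconst i0 mu0 mu1 P0 P1 (lt_trans a0 ab) bB.
pose M := Num.max 0 (q / (b - a)).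
have M0 : 0 <= M by rewrite le_max lexx.
have phi_neg s : M <= s -> phi s <= 0.
  move=> Ms; have s_ge0 := le_trans M0 Ms.
  have : q <= s * (b - a).
    by rewrite -ler_pdivrMr ?subr_gt0// (le_trans _ Ms)// le_max lexx orbT.
  have := hq s s_ge0; rewrite /phi; move: (L s) => l; lra.
have cphi : continuous phi.
  move=> s; apply: (@continuousB _ _ _ (fun s => a * s) L).
    by apply: (@continuousM _ _ (fun=> a) (fun s : R => s)); [exact: cst_continuous|exact: cvg_id].
  exact: (continuous_Lambda i0 mu0 mu1 P0 P1).
have [t tM tmax] := EVT_max M0 (continuous_subspaceT cphi).
have s0M : s0 \in `[0, M].
  rewrite in_itv/= ltW//=; rewrite leNgt; apply/negP => Ms.
  by have := phi_neg s0 (ltW Ms); rewrite leNgt phi_pos.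
have phit : 0 < phi t := lt_le_trans phi_pos (tmax _ s0M).
exists t => [|s s_ge0].
  move: tM; rewrite in_itv/= => /andP[]; rewrite le_eqVlt => /predU1P[t0|//] _.
  by move: phit; rewrite -t0 /phi mulr0 L0 subrr ltxx.
rewrite -/(phi s) -/(phi t); have [sM|/ltW sM] := leP s M.
  by apply: tmax; rewrite in_itv/= s_ge0.
exact: le_trans (phi_neg s sM) (ltW phit).
Qed.

Lemma rate_saddle a t : 0 < t -> (forall s, 0 <= s -> a * s - L s <= a * t - L t) ->
  rate mu P h a = a * t - L t.
Proof.
move=> t0 tmax; rewrite /rate; set S := [set y | _].
have ubS : ubound S (a * t - L t) by move=> _ [s s0 ->]; exact: tmax (ltW s0).
have St : S (a * t - L t) by exists t.
apply/eqP; rewrite eq_le; apply/andP; split.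
  by apply: ge_sup => //; exists (a * t - L t).
by apply: ub_le_sup => //; exists (a * t - L t).
Qed.

(** Maximality at [t] gives [a s <= L (t + s) - L t]; with the quadratic upper bound this forces the
    tilted drift [m] to equal [a]. *)
Lemma saddle_centered a t u : 0 < t -> (forall s, 0 <= s -> a * s - L s <= a * t - L t) ->
  (forall j, 0 < u j) -> (forall j, mxop (tilt P h t) u j = expR (L t) * u j) ->
  exists x : 'I_d -> R, forall j, \sum_k doob P h t (L t) u j k * (h j k - a + x k - x j) = 0.
Proof.
move=> t0 tmax u0 ue.
have [m [x [Y [Y0 hm H]]]] := Lambda_quadratic i0 mu0 mu1 P0 P1 u0 ue.
have ma : m - a = 0.
  (* Enlarging [Y] to at least [t^-1] forces [|s| <= t], so [t + s] stays in the range where [t] is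
     known to be maximal. *)
  apply: (@drift_le0 _ (Num.max Y t^-1)) => [|s sY]; first by rewrite le_max Y0.
  have Yle : Y <= Num.max Y t^-1 by rewrite le_max lexx.
  have sY' : `|s| * Y <= 1 / 2 by rewrite (le_trans _ sY)// ler_wpM2l.
  have st : `|s| <= t.
    have : `|s| * t^-1 <= 1.
      rewrite (@le_trans _ _ (1 / 2))// ?(le_trans _ sY)// ?ler_wpM2l// ?le_max ?lexx ?orbT//.
      lra.
    by rewrite ler_pdivrMr// mul1r.
  have ts0 : 0 <= t + s by have := ler_norm (- s); rewrite normrN; lra.
  have h1 := tmax _ ts0; have h2 := H s sY'.
  have h3 : s ^+ 2 * Y ^+ 2 <= s ^+ 2 * Num.max Y t^-1 ^+ 2.
    by rewrite ler_wpM2l ?sqr_ge0// lerXn2r ?nnegrE// (le_trans Y0).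
  move: (L t) (L (t + s)) (Num.max Y t^-1 ^+ 2) h1 h2 h3 => l1 l2 z h1 h2 h3; lra.
exists x => j.
transitivity (m - (\sum_k doob P h t (L t) u j k) * a).
  rewrite -(hm j) mulr_suml -sumrB; apply: eq_bigr => k _; ring.
by rewrite sum_doob// mul1r ma.
Qed.

End Saddle.

(** * Conclusion *)

Section Nonlattice.
Context {R : realType} (d : nat).

Lemma cycle_defect_neq0 (h : 'M[R]_d) a : nonlattice h ->
  forall s, 0 < s -> forall j, cycle_defect (fun j k => h j k - a) j s != 0.
Proof.
move=> nl s s0 j; apply/negP; rewrite /cycle_defect psumr_eq0 => [/allP H|p _]; last first.
  by rewrite subr_ge0 cos_le1.
(* Both compared paths have two steps, so [a] cancels; fixing [j] exhibits [s h l k] as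
   [s h j j + s h j k - s h j l] modulo [2 pi]. *)
apply: nl; exists (s * h j j), s, (fun k => s * h j k); split; first by rewrite gt_eqF.
move=> l k; have := H (l, k); rewrite mem_index_enum => /(_ isT)/=.
rewrite subr_eq0 => /eqP/esym/cos_eq1[m hm]; exists m; rewrite -hm; ring.
Qed.

End Nonlattice.

Section Final.
Context {R : realType} (d : nat) (i0 : 'I_d) (mu : 'I_d -> R) (P h : 'M[R]_d).
Hypothesis mu0 : forall i, 0 <= mu i.
Hypothesis mu1 : \sum_i mu i = 1.
Hypothesis P0 : forall j k, 0 < P j k.
Hypothesis P1 : forall j, \sum_k P j k = 1.
Local Notation L := (Lambda mu P h).
Local Notation path N := {ffun 'I_N.+2 -> 'I_d}.
Variables (a t : R) (u x : 'I_d -> R).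
Hypothesis h_nonlattice : nonlattice h.
Hypothesis t0 : 0 < t.
Hypothesis u0 : forall j, 0 < u j.
Hypothesis u_eigen : forall j, mxop (tilt P h t) u j = expR (L t) * u j.
Hypothesis centered : forall j, \sum_k doob P h t (L t) u j k * (h j k - a + x k - x j) = 0.

Let Q := doob P h t (L t) u.
Let z j k := h j k - a.
Let w N (p : path N) := path_prob mu P p * expR (t * SN h p - L t * N%:R).
Let T N (p : path N) := SN h p - a * N%:R.
Let g k : R := (u k)^-1.
Let c k := start_weight mu P k * u k.

Let Q0 j k : 0 < Q j k. Proof. exact: doob_gt0. Qed.
Let Q1 j : \sum_k Q j k = 1. Proof. exact: sum_doob. Qed.
Let c0 k : 0 <= c k. Proof. by rewrite mulr_ge0 ?start_weight_ge0 ?(ltW (u0 k)). Qed.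
Let w0 N (p : path N) : 0 <= w p.
Proof. by rewrite mulr_ge0 ?path_prob_ge0 ?expR_ge0. Qed.

Let char N s : R[i] := \sum_k (c k)%:C * iter N (mxop (twist Q z s)) (fun k => (g k)%:C) k.

Let sum_cos N s b :
  \sum_p @w N p * cos (s * (@T N p - b)) = complex.Re (cis (- (s * b)) * char N s).
Proof.
rewrite /char -(char_path mu P h t (L t) a u0 N s) mulr_sumr cre_sum; apply: eq_bigr => p _.
by rewrite mulrCA -cisD cre_realM; congr (_ * cos _); rewrite /T; ring.
Qed.

Let char_decay A : 0 < A -> exists C c' : R, [/\ 0 <= C, 0 < c' &
  forall n (b s : R), 0 <= s -> s <= A ->
  `|\sum_p @w n p * cos (s * (@T n p - b))| <= C * expR (- c' * s ^+ 2 * n%:R)].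
Proof.
move=> A0; have [C [c' [C0 c'0 H]]] := twist_decay i0 Q0 Q1 (cycle_defect_neq0 a h_nonlattice) A0.
have [G G0 hG] := fin_bounded g.
exists ((\sum_k c k) * (C * G)), c'; split => // [|n b s s0 sA].
  by rewrite mulr_ge0 ?mulr_ge0// sumr_ge0.
rewrite sum_cos; apply: le_trans (cre_le_cmod _) _; rewrite cmodM cmod_cis mul1r.
apply: le_trans (cmod_sum _ _ _) _; rewrite -mulrA mulr_suml; apply: ler_sum => k _.
rewrite cmodM cmod_real ger0_norm// ler_wpM2l//; apply: H; first by rewrite s0.
by move=> k'; rewrite cmod_real.
Qed.

Let char_cvg : exists psi : R -> R, forall u b : R, 0 <= u ->
  \sum_p @w n p * cos (u * ((@T n p - b) / Num.sqrt n%:R)) @[n --> \oo] --> psi u.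
Proof.
have [sigma s0 H] := twist_clt i0 Q0 Q1 centered.
have [m [y gE]] := poisson_equation i0 g Q0 Q1.
have {}H := H g y m gE.
pose E v : R := m * expR (- (sigma * v ^+ 2 / 2)).
exists (fun v => (\sum_k c k) * E v) => v b v0.
pose s n : R := v / Num.sqrt n%:R.
have s_cvg : s n @[n --> \oo] --> (0 : R).
  rewrite -[X in _ --> X](mulr0 v); apply: cvgM; first exact: cvg_cst.
  exact: cvg_invsqrt.
pose err n := \sum_k c k * cmod (iter n (mxop (twist Q z (s n))) (fun k => (g k)%:C) k - (E v)%:C).
have err0 : err n @[n --> \oo] --> (0 : R).
  have E0 : 0 = \sum_k c k * 0 by rewrite big1// => k _; rewrite mulr0.
  rewrite [X in _ --> X]E0.
  apply: cvg_big => [|k _]; first exact: add_continuous.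
  by apply: cvgM; [exact: cvg_cst|exact: H].
(* The first term measures how far the phase of the shift [b] is from [1], and vanishes in the
   limit; the second is the error in the Gaussian limit. *)
pose D n := 2 * `|s n * b| * `|(\sum_k c k) * E v| + err n.
have D0 : D n @[n --> \oo] --> (0 : R).
  rewrite -[X in _ --> X]addr0; apply: cvgD => //.
  rewrite -[X in _ --> X](mul0r `|(\sum_k c k) * E v|); apply: cvgM; last exact: cvg_cst.
  rewrite -[X in _ --> X](mulr0 2); apply: cvgM; first exact: cvg_cst.
  rewrite -[X in _ --> X](@normr0 _ R); apply: cvg_norm.
  rewrite -[X in _ --> X](mul0r b); apply: cvgM => //; exact: cvg_cst.
have main n : `|(\sum_k c k) * E v - \sum_p @w n p * cos (v * ((@T n p - b) / Num.sqrt n%:R))| <= D n.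
  have -> : \sum_p @w n p * cos (v * ((@T n p - b) / Num.sqrt n%:R)) =
      complex.Re (cis (- (s n * b)) * char n (s n)).
    rewrite -sum_cos; apply: eq_bigr => p _; congr (_ * cos _).
    by rewrite /s mulrA mulrAC.
  set l := (\sum_k c k) * E v.
  have -> : l - complex.Re (cis (- (s n * b)) * char n (s n)) =
      complex.Re (l%:C - cis (- (s n * b)) * char n (s n)).
    by case: (_ * char _ _).
  apply: le_trans (cre_le_cmod _) _.
  have -> : l%:C - cis (- (s n * b)) * char n (s n) =
      (l%:C - cis (- (s n * b)) * l%:C) + cis (- (s n * b)) * (l%:C - char n (s n)) by ring.
  apply: le_trans (cmodD _ _) _; apply: lerD.
    rewrite -[X in X - _]mul1r -mulrBl cmodM cmod_real ler_wpM2r//.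
    by rewrite cmodBC (le_trans (cmod_cis_sub1 _))// normrN.
  rewrite cmodM cmod_cis mul1r.
  have -> : l%:C - char n (s n) = \sum_k (c k)%:C *
      ((E v)%:C - iter n (mxop (twist Q z (s n))) (fun k => (g k)%:C) k).
    rewrite /char /l mulr_suml rmorph_sum -sumrB; apply: eq_bigr => k _.
    by rewrite mulrBr -rmorphM.
  apply: le_trans (cmod_sum _ _ _) _; apply: ler_sum => k _.
  by rewrite cmodM cmod_real ger0_norm// cmodBC.
apply/cvgrPdist_le => e e0.
have D1 : \forall n \near \oo, `|0 - D n| <= e by have /cvgrPdist_le := D0; apply.
apply: filterS D1 => n; rewrite sub0r normrN => Dn.
by rewrite (le_trans (main n))// (le_trans _ Dn)// ler_norm.
Qed.

Lemma tilted_tail_cvg :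
  cvgn (fun n => Num.sqrt n%:R * \sum_p @w n p * tail_exp t (@T n p)).
Proof.
have [psi hpsi] := char_cvg.
exact: (@local_limit_exp_tail R (fun n => path n) w T psi w0 char_decay hpsi t t0).
Qed.

(** The exponent splits as [(a t - L t) n = (t SN - L t n) - t (SN - a n)], a tilted weight and an
    exponential tail. *)
Lemma prob_ge_tilted n : prob_ge mu P h a n * expR ((a * t - L t) * n%:R) =
  \sum_p @w n p * tail_exp t (@T n p).
Proof.
rewrite /prob_ge /expect mulr_suml; apply: eq_bigr => p _.
rewrite /tail_exp /w /T subr_ge0; case: ifP => _; last by rewrite !mulr0 mul0r.
by rewrite mulr1 -mulrA -expRD; congr (_ * expR _); ring.
Qed.

End Final.

Theorem theorem4p10 (R : realType) (d : nat) (mu : 'I_d -> R) (P h : 'M[R]_d) :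
  (forall i, 0 <= mu i) -> \sum_i mu i = 1 ->
  (forall j k, 0 < P j k) -> (forall j, \sum_k P j k = 1) ->
  nonlattice h ->
  (fun N : nat => @expect R d mu P N (@SN R d h N) / N%:R) @ \oo --> (0 : R) ->
  forall a : R, 0 < a -> a < Bconst h ->
  exists D0 : R,
    (fun N : nat =>
       (prob_ge mu P h a N * expR (rate mu P h a * N%:R)
          - D0 / Num.sqrt (N%:R)) * Num.sqrt (N%:R)) @ \oo --> (0 : R).
Proof.
move=> mu0 mu1 P0 P1 nl hE a a0 aB.
(* A state exists because [mu] has total mass [1]. *)
have i0 : 'I_d.
  case: d mu P h mu0 mu1 P0 P1 nl hE aB => [|n] mu P h mu0 mu1 *; last exact: ord0.
  by move: mu1; rewrite big_ord0 => /eqP; rewrite eq_sym oner_eq0.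
have [t t0 tmax] := exists_saddle i0 mu0 mu1 P0 P1 a0 aB hE.
have [u u0 ue] := Lambda_eigen i0 h mu0 mu1 P0 P1 t.
have [x hx] := saddle_centered i0 mu0 mu1 P0 P1 t0 tmax u0 ue.
have /cvg_ex[D hD] := tilted_tail_cvg i0 mu0 P0 nl t0 u0 ue hx.
exists D; rewrite (rate_saddle t0 tmax).
(* The index is shifted so that [sqrt N] is nonzero and can be cancelled. *)
rewrite -(cvg_shiftS _ (nbhs (0 : R))).
move: hD; rewrite -(cvg_shiftS _ (nbhs D)) => hD.
have -> : (fun N : nat => (prob_ge mu P h a N.+1 * expR ((a * t - Lambda mu P h t) * N.+1%:R) -
    D / Num.sqrt N.+1%:R) * Num.sqrt N.+1%:R) =
  (fun N : nat => Num.sqrt N.+1%:R * \sum_(p : {ffun 'I_N.+3 -> 'I_d})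
    (path_prob mu P p * expR (t * SN h p - Lambda mu P h t * N.+1%:R)) *
    tail_exp t (SN h p - a * N.+1%:R) - D).
  apply/funext => N; rewrite prob_ge_tilted mulrBl divfK; first by rewrite mulrC.
  by rewrite gt_eqF// sqrtr_gt0.
have := cvgB hD (@cvg_cst _ D nat \oo _).
by rewrite subrr => /(_ _ _); apply.
Qed.
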